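(* Let $n\ge2$ and let $K:\mathbb{B}^n\times\mathbb{B}^n\to\mathbb{R}$ be an $O(n)$-invariant continuous kernel, associated with continuous radial kernels $c_l:[0,1]\times[0,1]\to\mathbb{R}$, $l\ge0$, via the expansion $K(r_1\theta_1,r_2\theta_2)=\sum_{l=0}^\infty c_l(r_1,r_2)C_l^{n/2-1}(\theta_1^\top\theta_2)$. Then the corresponding RKHS and norm are given by $$\mathbb{H}(K)=\left\{\sum_{l=0}^\infty\sum_{k=1}^{N(n,l)}h_{lk}(r)Y_{lk}(\theta):\ h_{lk}\in\mathbb{H}(c_l),\ \sum_{l=0}^\infty\sum_{k=1}^{N(n,l)}\frac{\|h_{lk}\|^2_{\mathbb{H}(c_l)}}{p_l^{n/2-1}|\mathbb{S}^{n-2}|}<\infty\right\},$$ $$\left\|\sum_{l=0}^\infty\sum_{k=1}^{N(n,l)}h_{lk}Y_{lk}\right\|^2_{\mathbb{H}(K)}=\sum_{l=0}^\infty\sum_{k=1}^{N(n,l)}\frac{\|h_{lk}\|^2_{\mathbb{H}(c_l)}}{p_l^{n/2-1}|\mathbb{S}^{n-2}|}<\infty,$$ where $\{Y_{lk}(\theta):k=1,2,\dots,N(n,l)\}$ is an orthonormal basis of $\mathcal{H}_l(\mathbb{S}^{n-1})$ with respect to the $\mathcal{L}_2$ norm.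
   Context: $\mathbb{B}^n$ is the closed unit ball and $\mathbb{S}^{n-1}$ the unit sphere of $\mathbb{R}^n$; points of $\mathbb{B}^n$ are written $r\theta$ with $r\in[0,1]$, $\theta\in\mathbb{S}^{n-1}$; $|\mathbb{S}^m|$ is the surface measure of $\mathbb{S}^m$ ($|\mathbb{S}^0|=2$). A kernel on a set $E$ is a real symmetric positive semidefinite function on $E\times E$, and $\mathbb{H}(\cdot)$ denotes its RKHS of real functions. $K$ is $O(n)$-invariant if $K(\mathbf{z}_1,\mathbf{z}_2)=K(R^\top\mathbf{z}_1,R^\top\mathbf{z}_2)$ for all $R\in O(n)$. For $\lambda>-1/2$, $C_l^\lambda$ is the Gegenbauer polynomial of degree $l$: orthogonal polynomials on $[-1,1]$ for the weight $(1-s^2)^{\lambda-1/2}$, normalized by $C_l^\lambda(1)=1$; $p_l^\lambda:=\int_{-1}^1(1-s^2)^{\lambda-1/2}C_l^\lambda(s)^2\,ds$. Any continuous $O(n)$-invariant kernel $K$ on $\mathbb{B}^n$ has an absolutely and uniformly convergent expansion as in the claim, where the $c_l$ are continuous kernels on $[0,1]$ (radial kernels) with $c_l(0,0)=0$ for $l\ge1$ and $\max_{r\in[0,1]}\sum_lc_l(r,r)<\infty$, given by $c_l(r_1,r_2)=\frac{1}{p_l^{n/2-1}|\mathbb{S}^{n-2}|}\int_{\mathbb{S}^{n-1}}K(r_1\theta_1,r_2\theta_2)C_l^{n/2-1}(\theta_1^\top\theta_2)\,d\theta_2$ for any $\theta_1$. $\mathcal{H}_l(\mathbb{S}^{n-1})$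 is the space of spherical harmonics of degree $l$ (restrictions to the sphere of real homogeneous harmonic polynomials of degree $l$ on $\mathbb{R}^n$) and $N(n,l)=\dim\mathcal{H}_l(\mathbb{S}^{n-1})$. *)

(* Defs.v *)
From HB Require Import structures.
From mathcomp Require Import all_boot all_order all_algebra.

Set Implicit Arguments.
Unset Strict Implicit.
Unset Printing Implicit Defensive.

(* The notations of mpoly and of MathComp-Analysis cannot be active together,
   hence this module before the import of MathComp-Analysis. *)
Module HarmonicPoly.
From mathcomp Require Import mpoly.
Import GRing.Theory.
Local Open Scope ring_scope.


Definition homogeneous_harmonic (R : comNzRingType) (n l : nat)
    (p : {mpoly R[n]}) : Prop :=
  p \is l.-homog /\ \sum_(i < n) (p^`M(i))^`M(i) = 0.

(* Restrictions of these polynomials to a set T of points v, given by their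
   coordinates. *)
Definition harmonic_restriction (R : comNzRingType) (n l : nat) (T : Type)
    (v : T -> 'I_n -> R) (Y : T -> R) : Prop :=
  exists2 p : {mpoly R[n]},
    homogeneous_harmonic l p & forall t, Y t = p.@[v t].
End HarmonicPoly.

From mathcomp Require Import all_classical all_reals all_analysis.

Import Order.TTheory GRing.Theory Num.Theory.
Import numFieldNormedType.Exports.

Local Open Scope classical_set_scope.
Local Open Scope ring_scope.

Definition psd_kernel (R : realType) (T : Type) (K : T -> T -> R) : Prop :=
  (forall x y, K x y = K y x) /\
  (forall (m : nat) (x : 'I_m -> T) (a : 'I_m -> R),
     0 <= \sum_i \sum_j a i * a j * K (x i) (x j)).

(* A space of real functions on T together with an inner product; the values
   of [ip] outside of [carrier] are irrelevant. *)
Record ip_space (R : realType) (T : Type) := IpSpace {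
  carrier : set (T -> R) ;
  ip : (T -> R) -> (T -> R) -> R }.

Definition sqnorm (R : realType) (T : Type) (H : ip_space R T) (f : T -> R) : R :=
  ip H f f.

Record is_hilbert (R : realType) (T : Type) (H : ip_space R T) : Prop := {
  hilbert0 : carrier H 0 ;
  hilbertD : forall (a : R) f g,
    carrier H f -> carrier H g -> carrier H (a *: f + g) ;
  ipC : forall f g, carrier H f -> carrier H g -> ip H f g = ip H g f ;
  ipDl : forall (a : R) f g k,
    carrier H f -> carrier H g -> carrier H k ->
    ip H (a *: f + g) k = a * ip H f k + ip H g k ;
  ip_ge0 : forall f, carrier H f -> 0 <= ip H f f ;
  ip_eq0 : forall f, carrier H f -> ip H f f = 0 -> f = 0 ;
  hilbert_complete : forall u : nat -> T -> R,
    (forall m, carrier H (u m)) ->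
    (forall e : R, 0 < e -> exists N : nat, forall p q : nat,
       (N <= p)%N -> (N <= q)%N -> Num.sqrt (sqnorm H (u p - u q)) < e) ->
    exists2 f, carrier H f &
      (fun m => Num.sqrt (sqnorm H (u m - f))) @ \oo --> (0 : R) }.

(* By the Moore-Aronszajn theorem, exactly one space of functions satisfies
   this for a given positive semidefinite kernel K (up to the irrelevant values
   of [ip]). *)
Record is_rkhs (R : realType) (T : Type) (K : T -> T -> R) (H : ip_space R T)
    : Prop := {
  rkhs_hilbert : is_hilbert H ;
  rkhs_section : forall x, carrier H (K x) ;
  rkhs_reproducing : forall f x, carrier H f -> f x = ip H f (K x) }.

Definition dot (R : realType) (n : nat) (x y : 'cV[R]_n) : R :=
  (x^T *m y) 0 0.

(* The library norm on matrices is the sup norm, so the Euclidean ball and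
   sphere are written with the dot product. *)
Definition ball_set (R : realType) (n : nat) : set 'cV[R]_n :=
  [set x | Num.sqrt (dot x x) <= 1].

Definition sphere_set (R : realType) (n : nat) : set 'cV[R]_n :=
  [set x | Num.sqrt (dot x x) = 1].

Definition unit_itv_set (R : realType) : set R := [set r | 0 <= r <= 1].

Notation cball R n := (set_type (@ball_set R n)).
Notation sphere R n := (set_type (@sphere_set R n)).
Notation unit_itv R := (set_type (@unit_itv_set R)).

Lemma dotZZ (R : realType) n (a : R) (x : 'cV[R]_n) :
  dot (a *: x) (a *: x) = a ^+ 2 * dot x x.
Proof.
by rewrite /dot -scalemxAr linearZ/= -scalemxAl scalerA mxE expr2.
Qed.

Lemma dot_sphere (R : realType) n (t : sphere R n) : dot (\val t) (\val t) = 1.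
Proof.
have /set_mem/= h := valP t.
have d0 : 0 < dot (\val t) (\val t) by rewrite -sqrtr_gt0 h ltr01.
by rewrite -(sqr_sqrtr (ltW d0)) h expr1n.
Qed.

Lemma polar_subproof (R : realType) n (r : unit_itv R) (t : sphere R n) :
  \val r *: \val t \in @ball_set R n.
Proof.
have /set_mem/= /andP[r0 r1] := valP r.
by rewrite inE /ball_set/= dotZZ dot_sphere mulr1 sqrtr_sqr ger0_norm.
Qed.

Definition polar (R : realType) (n : nat) (r : unit_itv R) (t : sphere R n)
  : cball R n := exist _ (\val r *: \val t) (polar_subproof r t).

Definition orthogonal_invariant (R : realType) (n : nat)
    (K : cball R n -> cball R n -> R) : Prop :=
  forall U : 'M[R]_n, U^T *m U = 1%:M ->
  forall z1 z2 w1 w2 : cball R n,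
    \val w1 = U^T *m \val z1 -> \val w2 = U^T *m \val z2 ->
    K z1 z2 = K w1 w2.

Lemma sph_subproof (R : realType) n (phi : R) (w : sphere R n.+1) :
  col_mx (cos phi)%:M (sin phi *: \val w) \in @sphere_set R (1 + n.+1).
Proof.
rewrite inE /sphere_set/= /dot tr_col_mx mul_row_col mxE.
rewrite -/(dot (sin phi *: \val w) (sin phi *: \val w)) dotZZ dot_sphere mulr1.
by rewrite tr_scalar_mx -scalar_mxM mxE eqxx mulr1n -expr2 cos2Dsin2 sqrtr1.
Qed.

(* The point (cos phi, sin phi * w), for phi in [0, pi]. *)
Definition sph (R : realType) (n : nat) (phi : R) (w : sphere R n.+1)
  : sphere R n.+2 := exist _ (col_mx (cos phi)%:M (sin phi *: \val w))
                             (sph_subproof phi w).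

Lemma pole_subproof (R : realType) (b : bool) :
  (((-1) ^+ b)%:M : 'cV[R]_1) \in @sphere_set R 1.
Proof.
rewrite inE /sphere_set/= /dot tr_scalar_mx -scalar_mxM mxE eqxx mulr1n.
by rewrite -expr2 sqrr_sign sqrtr1.
Qed.

Definition pole (R : realType) (b : bool) : sphere R 1 :=
  exist _ (((-1) ^+ b)%:M : 'cV[R]_1) (pole_subproof R b).

(* Integral of f over the unit sphere of R^n for the (unnormalized) surface
   measure, in hyperspherical coordinates: the area element of S^(m+1) at
   (cos phi, sin phi * w) is (sin phi)^m dphi dw, with w in S^m; the measure on
   S^0 = {1, -1} is the counting measure. The value for n = 0 is irrelevant. *)
Fixpoint sphere_integral (R : realType) (n : nat) : (sphere R n -> R) -> R :=
  match n return (sphere R n -> R) -> R with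
  | 0 => fun _ => 0
  | k.+1 =>
    (match k return ((sphere R k -> R) -> R) -> (sphere R k.+1 -> R) -> R with
     | 0 => fun _ f => f (pole R false) + f (pole R true)
     | m.+1 => fun int_Sm f =>
         \int[lebesgue_measure]_(phi in `[0, pi])
           (sin phi ^+ m * int_Sm (fun w => f (sph phi w)))
     end) (sphere_integral (n := k))
  end.

Definition sphere_area (R : realType) (m : nat) : R :=
  sphere_integral (fun _ : sphere R m.+1 => 1).

Definition L2_ip (R : realType) (n : nat) (f g : sphere R n -> R) : R :=
  sphere_integral (fun t => f t * g t).

Definition gegenbauer_ip (R : realType) (lambda : R) (p q : {poly R}) : R :=
  \int[lebesgue_measure]_(s in `[-1, 1])
    ((1 - s ^+ 2) `^ (lambda - 2^-1) * p.[s] * q.[s]).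

(* C is the sequence of orthogonal polynomials on [-1, 1] for the weight
   (1 - s^2)^(lambda - 1/2), normalized to take the value 1 at 1. *)
Definition is_gegenbauer (R : realType) (lambda : R) (C : nat -> {poly R}) : Prop :=
  [/\ forall l, size (C l) = l.+1,
      forall l m, l != m -> gegenbauer_ip lambda (C l) (C m) = 0
    & forall l, (C l).[1] = 1].

Definition gegenbauer_p (R : realType) (lambda : R) (C : nat -> {poly R})
    (l : nat) : R := gegenbauer_ip lambda (C l) (C l).

Definition spherical_harmonics (R : realType) (n l : nat) : set (sphere R n -> R) :=
  [set Y | HarmonicPoly.harmonic_restriction l
             (fun (t : sphere R n) (i : 'I_n) => \val t i 0) Y].

Definition is_basis (R : realType) (T : Type) (V : set (T -> R)) (d : nat)
    (b : 'I_d -> T -> R) : Prop :=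
  [/\ forall k, V (b k),
      forall a : 'I_d -> R, \sum_k a k *: b k = 0 -> forall k, a k = 0
    & forall f, V f -> exists a : 'I_d -> R, f = \sum_k a k *: b k].

(* The dimension of a (finite-dimensional) space V of functions. *)
Definition fdim (R : realType) (T : Type) (V : set (T -> R)) : nat :=
  xget 0%N [set d | exists b : 'I_d -> T -> R, is_basis V b].

Definition Nharm (R : realType) (n l : nat) : nat :=
  fdim (@spherical_harmonics R n l).

Definition is_L2_orthonormal_basis (R : realType) (n : nat)
    (V : set (sphere R n -> R)) (d : nat) (b : 'I_d -> sphere R n -> R) : Prop :=
  is_basis V b /\ (forall i j, L2_ip (b i) (b j) = (i == j)%:R).

Definition coef_family (R : realType) (n : nat) :=
  forall l : nat, 'I_(Nharm R n l) -> unit_itv R -> R.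

(* f is the function r * t |-> sum_l sum_k h_lk(r) Y_lk(t) on the ball, the
   series over l being convergent at each point. *)
Definition is_expansion (R : realType) (n : nat)
    (Y : forall l : nat, 'I_(Nharm R n l) -> sphere R n -> R)
    (h : coef_family R n) (f : cball R n -> R) : Prop :=
  forall (r : unit_itv R) (t : sphere R n),
    series (fun l => \sum_k h l k r * Y l k t) @ \oo --> f (polar r t).

(* sum_l sum_k ||h_lk||^2_{H(c_l)} / (p_l |S^(n-2)|), in [0, +oo]. *)
Definition weighted_sum (R : realType) (n : nat) (C : nat -> {poly R})
    (Hc : nat -> ip_space R (unit_itv R)) (h : coef_family R n) : \bar R :=
  (\sum_(0 <= l <oo) \sum_(k < Nharm R n l)
     (sqnorm (Hc l) (h l k) /
        (gegenbauer_p (n%:R / 2 - 1) C l * sphere_area R (n - 2)))%:E)%E.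

Definition admissible (R : realType) (n : nat) (C : nat -> {poly R})
    (Hc : nat -> ip_space R (unit_itv R)) (h : coef_family R n) : Prop :=
  (forall l k, carrier (Hc l) (h l k)) /\ (weighted_sum C Hc h < +oo)%E.

(* Main.v *)
Require Import Defs.
From HB Require Import structures.
From mathcomp Require Import all_boot all_order all_algebra.
From mathcomp Require Import ring lra zify.

(* The Hilbert space H(K) is determined by inequalities: a function f lies in
   H(K) with |f|^2 <= M if and only if (sum_i a_i f(x_i))^2 <= M * |sum_i a_i
   K(x_i, .)|^2 for all finite families, the converse being Riesz's theorem
   (minimize |g|^2 - 2 L(g) over the span of the sections).

   The addition theorem C_l(s.t) = mu_l sum_k Y_lk(s) Y_lk(t), with
   mu_l = p_l |S^(n-2)|, turns the expansion of K into
   sum_l mu_l c_l(r1, r2) sum_k Y_lk(t1) Y_lk(t2). By Cauchy-Schwarz the sum of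
   an admissible series satisfies the inequalities with M the weighted sum.
   Conversely f in H(K) is a limit of finite combinations of sections, whose
   coefficient families sum_i a_i mu_l Y_lk(t_i) c_l(r_i, .) have the same
   norm, hence converge. Orthogonality of the spherical harmonics makes the
   coefficients unique, so both norm bounds are equalities.

   Harmonic analysis on the sphere is derived from one identity: if p is a
   homogeneous polynomial of degree d, the integral of its Laplacian over the
   sphere is d (d + n - 2) times that of p. It is checked on monomials in
   hyperspherical coordinates. Orthogonality of different degrees and the
   Funk-Hecke formula follow by induction on the degree, with no appeal to
   rotation invariance of the integral. *)

Set Implicit Arguments.
Unset Strict Implicit.
Unset Printing Implicit Defensive.

(** * Polynomials and their Laplacian *)

Section PolynomialFunctions.
Import GRing.Theory.
Local Open Scope ring_scope.
Variables (R : comNzRingType) (n : nat) (T : Type) (v : T -> 'I_n -> R).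

(** [sphere_integral] is an iterated integral in one fixed system of coordinates, and its additivity
    depends on the integrability of every inner integral. The harmonic analysis therefore stays
    within restrictions of polynomials, where integrals reduce to moments of powers of cosine and
    sine. In particular no series is integrated term by term: coefficients are read off partial
    sums, the remainder being controlled by a majorant that does not depend on the point of the
    sphere. A second obstacle is the centre of the ball, where all directions give the same point. A
    series in polar coordinates is well defined there because its terms of positive degree vanish at
    radius 0, which comes from c_l(0, 0) = 0 for l >= 1; this is derived from the expansion of K at
    the centre. The constant p_l |S^(n-2)| arises as the squared L2 norm of the zonal function
    C_l(s.t), computed with s on the first axis. It is also the factor of the addition theorem,
    because both numbers equal the Funk-Hecke eigenvalue of C_l. *)

Definition monomial_fun (a : 'I_n -> nat) (t : T) : R := \prod_i v t i ^+ a i.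

(** Lists of coefficients and exponents stand for polynomials here, because the notations of [mpoly]
    clash with those of the analytic part. The sphere integral is shown to be linear on this
    class. *)
Definition is_polyfun (f : T -> R) : Prop := exists s : seq (R * ('I_n -> nat)),
  forall t, f t = \sum_(p <- s) p.1 * monomial_fun p.2 t.

Lemma is_polyfunD f g : is_polyfun f -> is_polyfun g ->
  is_polyfun (fun t => f t + g t).
Proof.
by move=> [s hs] [s' hs']; exists (s ++ s') => t; rewrite big_cat hs hs'.
Qed.

Lemma is_polyfunM f g : is_polyfun f -> is_polyfun g ->
  is_polyfun (fun t => f t * g t).
Proof.
move=> [s hs] [s' hs'].
exists [seq (p.1 * q.1, (fun i => p.2 i + q.2 i)%N) | p <- s, q <- s'] => t.
rewrite hs hs' big_allpairs_dep mulr_suml; apply: eq_bigr => p _.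
rewrite mulr_sumr; apply: eq_bigr => q _ /=; rewrite mulrACA; congr (_ * _).
by rewrite -big_split; apply: eq_bigr => i _; rewrite exprD.
Qed.

Lemma is_polyfun_cst c : is_polyfun (fun=> c).
Proof.
exists [:: (c, fun=> 0%N)] => t; rewrite big_seq1 /= /monomial_fun.
by rewrite big1 ?mulr1.
Qed.

End PolynomialFunctions.

Module ZonalHarmonics.
From mathcomp Require Import mpoly.
Import GRing.Theory Num.Theory.
Import HarmonicPoly.
Local Open Scope ring_scope.

Section Derivatives.
Variables (R : comNzRingType) (n : nat).
Implicit Types (p q : {mpoly R[n]}) (x s : 'I_n -> R).

Definition laplacian p := \sum_(i < n) p^`M(i)^`M(i).

Definition directional s p := \sum_(i < n) s i *: p^`M(i).

Definition linear_form s : {mpoly R[n]} := \sum_(i < n) s i *: 'X_i.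

Definition sqr_norm : {mpoly R[n]} := \sum_(i < n) 'X_i ^+ 2.

Lemma laplacian_is_linear : linear laplacian.
Proof.
move=> a p q; rewrite /laplacian scaler_sumr -big_split; apply: eq_bigr => i _.
by rewrite !linearP.
Qed.
HB.instance Definition _ :=
  GRing.isLinear.Build R {mpoly R[n]} {mpoly R[n]} *:%R laplacian
    laplacian_is_linear.

Lemma directional_is_linear s : linear (directional s).
Proof.
move=> a p q; rewrite /directional scaler_sumr -big_split; apply: eq_bigr => i _.
by rewrite linearP /= scalerDr !scalerA mulrC.
Qed.
HB.instance Definition _ s :=
  GRing.isLinear.Build R {mpoly R[n]} {mpoly R[n]} *:%R (directional s)
    (directional_is_linear s).

Lemma laplacianM p q : laplacian (p * q) =
  laplacian p * q + (\sum_i p^`M(i) * q^`M(i)) *+ 2 + p * laplacian q.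
Proof.
rewrite /laplacian mulr_suml mulr_sumr -sumrMnl -!big_split /=.
by apply: eq_bigr => i _; rewrite mderivM mderivD !mderivM; ring.
Qed.

Lemma directionalM s p q :
  directional s (p * q) = directional s p * q + p * directional s q.
Proof.
rewrite /directional mulr_suml mulr_sumr -big_split; apply: eq_bigr => i _ /=.
by rewrite mderivM scalerDr scalerAl scalerAr.
Qed.

Lemma mderiv_laplacian i p : (laplacian p)^`M(i) = laplacian p^`M(i).
Proof.
rewrite /laplacian linear_sum; apply: eq_bigr => j _ /=.
by rewrite mderiv_comm (mderiv_comm j i).
Qed.

Lemma directional_laplacian s p :
  laplacian (directional s p) = directional s (laplacian p).
Proof.
rewrite /directional linear_sum; apply: eq_bigr => j _ /=.
by rewrite linearZ /= mderiv_laplacian.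
Qed.

Lemma mderivXU i j : ('X_j : {mpoly R[n]})^`M(i) = (i == j)%:R.
Proof.
rewrite mderivX mnmE eq_sym; case: eqVneq => [->|_]; last by rewrite scale0r.
by rewrite scale1r -mpolyX0; congr 'X_[_]; apply/mnmP => k; rewrite !mnmE subnn.
Qed.

Lemma mderiv_linear_form s i : (linear_form s)^`M(i) = (s i)%:MP.
Proof.
rewrite /linear_form linear_sum /= (bigD1 i) //= big1 => [|j /negPf ji].
  by rewrite addr0 mderivZ mderivXU eqxx alg_mpolyC.
by rewrite mderivZ mderivXU eq_sym ji scaler0.
Qed.

Lemma laplacian_linear_form s : laplacian (linear_form s) = 0.
Proof. by rewrite /laplacian big1 // => i _; rewrite mderiv_linear_form mderivC. Qed.

Lemma directional_linear_form s x :
  directional s (linear_form x) = (\sum_i s i * x i)%:MP.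
Proof.
rewrite rmorph_sum; apply: eq_bigr => i _ /=.
by rewrite mderiv_linear_form mpolyCM -mul_mpolyC.
Qed.

Lemma grad_linear_form s p :
  \sum_i (linear_form s)^`M(i) * p^`M(i) = directional s p.
Proof. by apply: eq_bigr => i _; rewrite mderiv_linear_form mul_mpolyC. Qed.

Lemma mderiv_sqr_norm i : sqr_norm^`M(i) = 'X_i *+ 2.
Proof.
rewrite /sqr_norm linear_sum /= (bigD1 i) //= big1 => [|j /negPf ji].
  by rewrite addr0 expr2 mderivM mderivXU eqxx mul1r mulr1 mulr2n.
by rewrite expr2 mderivM mderivXU eq_sym ji mulr0 mul0r addr0.
Qed.

Lemma laplacian_sqr_norm : laplacian sqr_norm = (n * 2)%:R.
Proof.
rewrite /laplacian (eq_bigr (fun _ => 2%:R)) => [|i _].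
  by rewrite sumr_const card_ord natrM mulr_natl.
by rewrite mderiv_sqr_norm linearMn /= mderivXU eqxx.
Qed.

Lemma directional_sqr_norm s : directional s sqr_norm = linear_form s *+ 2.
Proof.
rewrite /linear_form -sumrMnl; apply: eq_bigr => i _ /=.
by rewrite mderiv_sqr_norm scalerMnr.
Qed.

Lemma mderiv_homog l p i : p \is l.-homog -> p^`M(i) \is l.-1.-homog.
Proof.
move=> hp; apply/dhomogP => m; rewrite mcoeff_msupp mcoeff_deriv.
case: (eqVneq (mdeg (m + U_(i))%MM) l) => [<- _|ne].
  by rewrite mdegD mdeg1 addn1.
by rewrite (dhomog_nemf_coeff hp ne) mul0rn eqxx.
Qed.

(** In degree 0 the truncated predecessor makes [mderiv_homog] give degree 0 again; the inductions
    on degrees need the derivative to vanish. *)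
Lemma mderiv_homog0 p i : p \is 0.-homog -> p^`M(i) = 0.
Proof.
move=> hp; apply/mpolyP => m; rewrite mcoeff_deriv mcoeff0.
rewrite (dhomog_nemf_coeff hp) ?mul0rn //=.
by rewrite -lt0n mdegD mdeg1 addn1.
Qed.

Lemma euler_homog l p : p \is l.-homog -> \sum_i 'X_i * p^`M(i) = p *+ l.
Proof.
move=> hp; rewrite [p in RHS]mpolyE -sumrMnl.
transitivity (\sum_(m <- msupp p) \sum_i p@_m *: ('X_i * 'X_[m]^`M(i))).
  rewrite exchange_big; apply: eq_bigr => i _ /=.
  rewrite {1}[p]mpolyE linear_sum mulr_sumr; apply: eq_bigr => m _ /=.
  by rewrite mderivZ scalerAr.
rewrite !big_seq; apply: eq_bigr => m hm; rewrite -[in RHS](dhomog_mf hp hm) /=.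
rewrite -scaler_sumr scalerMnr; congr (_ *: _).
rewrite mdegE -sumrMnr; apply: eq_bigr => i _.
rewrite mderivX -scalerAr -mpolyXD.
case mi: (m i) => [|k]; first by rewrite scale0r.
rewrite addmC submK ?scaler_nat //.
by apply/mnm_lepP => j; rewrite mnmE; case: eqP => // <-; rewrite mi.
Qed.

Lemma linear_form_homog s : linear_form s \is 1.-homog.
Proof.
by apply: rpred_sum => i _; apply: rpredZ; rewrite dhomogX /= mdeg1.
Qed.

Lemma sqr_norm_homog : sqr_norm \is 2.-homog.
Proof.
apply: rpred_sum => i _; have : 'X_i \is [in R[n], 1.-homog].
  by rewrite dhomogX /= mdeg1.
by move=> /(dhomogMn 2); rewrite mul1n.
Qed.

Lemma directional_homog s l p :
  p \is l.-homog -> directional s p \is l.-1.-homog.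
Proof. by move=> hp; apply: rpred_sum => i _; apply/rpredZ/mderiv_homog. Qed.

Lemma meval_linear_form s v : (linear_form s).@[v] = \sum_i s i * v i.
Proof. by rewrite raddf_sum; apply: eq_bigr => i _ /=; rewrite mevalZ mevalXU. Qed.

Lemma meval_directional s p :
  (directional s p).@[s] = (\sum_i 'X_i * p^`M(i)).@[s].
Proof.
by rewrite !raddf_sum; apply: eq_bigr => i _ /=; rewrite mevalZ mevalM mevalXU.
Qed.

Definition harmonic l p := homogeneous_harmonic l p.

Lemma harmonic_mderiv l p i : harmonic l p -> harmonic l.-1 p^`M(i).
Proof.
move=> [hp dp]; split; first exact: mderiv_homog.
by rewrite -/(laplacian _) -mderiv_laplacian /laplacian dp mderiv0.
Qed.

Lemma harmonic_directional s l p : harmonic l p -> harmonic l.-1 (directional s p).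
Proof.
move=> [hp dp]; split; first exact: directional_homog.
by rewrite -/(laplacian _) directional_laplacian /laplacian dp linear0.
Qed.

End Derivatives.

(** * Orthogonality and the Funk-Hecke formula for an abstract functional *)

Section Functional.
Variables (R : realFieldType) (n : nat) (n_gt1 : (1 < n)%N).
Variable I : {scalar {mpoly R[n]}}.
Hypothesis I_laplacian : forall d (p : {mpoly R[n]}), p \is d.-homog ->
  I (laplacian p) = (d * (d + n - 2))%:R * I p.
Implicit Types (p q : {mpoly R[n]}) (x : 'I_n -> R).

(** The Laplacian identity applied to [p * q], where harmonicity of [q] removes one of the three
    terms of the product rule. Since [0 < d] and [1 < n], the factor d (d + n - 2) can be inverted,
    so the integral is expressed by terms of lower degree. *)
Lemma functional_harmonicM d a p q : laplacian q = 0 -> p * q \is d.-homog ->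
    I (laplacian p * q) + I (\sum_i p^`M(i) * q^`M(i)) *+ 2 = a ->
  (0 < d)%N -> I (p * q) = (d * (d + n - 2))%:R^-1 * a.
Proof.
move=> q0 hpq <- d0; have dn : (d * (d + n - 2))%:R != 0 :> R by rewrite pnatr_eq0; nia.
apply: (mulfI dn); rewrite mulVKf // -(I_laplacian hpq) laplacianM q0.
by rewrite mulr0 addr0 raddfD raddfMn.
Qed.

(** For two harmonic factors only the gradient term survives, and partial derivatives are harmonic
    of one degree less. The descent ends at [l = 0], where the gradient of [p] is zero while the
    total degree is still positive. *)
Lemma harmonic_orthogonal l m p q :
  (l < m)%N -> harmonic l p -> harmonic m q -> I (p * q) = 0.
Proof.
elim: l => [|l IH] in m p q *; case: m => // m; rewrite ?ltnS => lm hp hq.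
  rewrite (@functional_harmonicM m.+1 0) ?mulr0 //; first exact: hq.2.
    exact: dhomogM hp.1 hq.1.
  rewrite [laplacian p]hp.2 mul0r linear0 add0r big1 ?linear0 ?mul0rn // => i _.
  by rewrite (mderiv_homog0 _ hp.1) mul0r.
rewrite (@functional_harmonicM (l.+1 + m.+1) 0) ?mulr0 //; first exact: hq.2.
  exact: dhomogM hp.1 hq.1.
rewrite [laplacian p]hp.2 mul0r linear0 add0r linear_sum big1 ?mul0rn // => i _.
by apply: (IH m) => //; [exact: harmonic_mderiv hp|exact: harmonic_mderiv hq].
Qed.

Lemma mderiv_exp p k i : (p ^+ k)^`M(i) = p ^+ k.-1 * p^`M(i) *+ k.
Proof.
elim: k => [|k IH]; first by rewrite expr0 -(@mpolyC1 n R) mderivC.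
rewrite exprS mderivM IH mulrS mulrC mulrnAr; congr (_ + _).
by case: k {IH} => [|k]; rewrite ?mulr0n // mulrA -exprS.
Qed.

Lemma laplacian_linear_form_exp x j :
  laplacian (linear_form x ^+ j) =
  (\sum_i x i ^+ 2 *+ (j * j.-1)) *: linear_form x ^+ j.-2.
Proof.
rewrite scaler_suml; apply: eq_bigr => i _.
rewrite mderiv_exp mderiv_linear_form linearMn /= mderivM mderivC mulr0 addr0.
rewrite mderiv_exp mderiv_linear_form mulrnAl -mulrnA -mulrA -mpolyCM -expr2.
by rewrite mulrC mul_mpolyC mulnC scalerMnl.
Qed.

Lemma grad_linear_form_exp x j q :
  \sum_i (linear_form x ^+ j)^`M(i) * q^`M(i) =
  (linear_form x ^+ j.-1 * directional x q) *+ j.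
Proof.
rewrite /directional mulr_sumr -sumrMnl; apply: eq_bigr => i _.
by rewrite mderiv_exp mderiv_linear_form mulrnAl -mulrA mul_mpolyC.
Qed.

Lemma linear_form_exp_homog x j l q :
  harmonic l q -> linear_form x ^+ j * q \is (j + l).-homog.
Proof.
move=> hq; apply: dhomogM hq.1.
by have := dhomogMn j (linear_form_homog x); rewrite mul1n.
Qed.

(** The Laplacian term lowers the exponent by two at fixed [m], and the gradient term lowers both
    [j] and [m] by one. Both keep the exponent below the degree, and both carry the factor [j],
    which ends the recursion. *)
Lemma funk_hecke_lt x j m q :
  (j < m)%N -> harmonic m q -> I (linear_form x ^+ j * q) = 0.
Proof.
elim/ltn_ind: j => j IH in m q * => jm hq.
rewrite (@functional_harmonicM (j + m) 0) ?mulr0 //; last lia; first exact: hq.2.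
  exact: linear_form_exp_homog.
rewrite laplacian_linear_form_exp -scalerAl linearZ grad_linear_form_exp /=.
rewrite raddfMn /=; case: j jm IH => [|j] jm IH.
  by rewrite mulr0n mul0n big1 // mul0rn mul0r addr0.
rewrite (IH j.-1 _ m) ?mulr0 ?add0r //; [|lia..].
by rewrite (IH j _ m.-1) ?mul0rn //; [lia|exact: harmonic_directional hq].
Qed.

Lemma homog0_const p : p \is 0.-homog -> p = (p@_0%MM)%:MP.
Proof.
move=> hp; apply/mpolyP => m; rewrite mcoeffC.
case: (eqVneq m 0%MM) => [->|m0]; first by rewrite mulr1.
by rewrite mulr0 (dhomog_nemf_coeff hp) // mdeg_eq0.
Qed.

(** The Laplacian term is killed by [funk_hecke_lt]; what remains involves the derivative of [q]
    along [x], whose value at [x] is a multiple of that of [q] by Euler's identity. The constant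
    thus depends on neither [x] nor [q]. *)
Lemma funk_hecke_eq m : exists kappa : R, forall x q,
  harmonic m q -> I (linear_form x ^+ m * q) = kappa * q.@[x].
Proof.
elim: m => [|m [k IH]].
  exists (I 1) => x q [hq _]; rewrite expr0 mul1r (homog0_const hq).
  by rewrite mevalC -[X in I X]mulr1 mul_mpolyC linearZ /= mulrC.
(* The 2 is that of the product rule. One factor [m.+1] comes from differentiating the power, the
   other from Euler's identity. *)
exists (((m.+1 + m.+1) * (m.+1 + m.+1 + n - 2))%:R^-1 *
        (k * m.+1%:R * m.+1%:R * 2)) => x q hq.
rewrite (@functional_harmonicM (m.+1 + m.+1)
  (k * m.+1%:R * m.+1%:R * 2 * q.@[x])) ?mulrA //; first exact: hq.2.
  exact: linear_form_exp_homog.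
rewrite laplacian_linear_form_exp -scalerAl linearZ grad_linear_form_exp /=.
rewrite (@funk_hecke_lt _ _ m.+1) ?mulr0 ?add0r //; last lia.
have hD := harmonic_directional x hq.
by rewrite raddfMn /= IH // meval_directional (euler_homog hq.1) mevalMn; ring.
Qed.

(** Degree at most [l] suffices for the Gegenbauer polynomial of degree [l]. Lower powers of the
    linear form integrate to zero, so only the coefficient of index [l] contributes. *)
Lemma funk_hecke l (g : {poly R}) : (size g <= l.+1)%N -> exists kappa : R,
  forall x q, harmonic l q ->
    I ((\sum_(j < l.+1) g`_j *: linear_form x ^+ j) * q) = kappa * q.@[x].
Proof.
move=> sg; have [k hk] := funk_hecke_eq l; exists (g`_l * k) => x q hq.
rewrite mulr_suml linear_sum big_ord_recr big1 /= => [|i _].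
  by rewrite add0r -scalerAl linearZ /= hk // mulrA.
by rewrite -scalerAl linearZ /= (@funk_hecke_lt _ _ l) ?mulr0.
Qed.

End Functional.

(** * Gegenbauer polynomials and their homogeneous zonal forms *)

Section TwoStep.
Variables (A : Type) (a b : A) (step : nat -> A -> A -> A).

Fixpoint two_step_pair l : A * A :=
  if l is k.+1 then
    let: (x, y) := two_step_pair k in (y, step k x y)
  else (a, b).

Definition two_step l := (two_step_pair l).1.

Lemma two_step_pairE l : two_step_pair l = (two_step l, two_step l.+1).
Proof. by rewrite /two_step /=; case: two_step_pair. Qed.

Lemma two_stepSS l :
  two_step l.+2 = step l (two_step l) (two_step l.+1).
Proof. by rewrite {1}/two_step /= two_step_pairE. Qed.

Lemma two_step_ind (P : nat -> A -> Prop) : P 0 a -> P 1 b ->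
  (forall l x y, P l x -> P l.+1 y -> P l.+2 (step l x y)) ->
  forall l, P l (two_step l).
Proof.
move=> P0 P1 PS l; suff: P l (two_step l) /\ P l.+1 (two_step l.+1) by case.
by elim: l => // l [? ?]; split=> //; rewrite two_stepSS; apply: PS.
Qed.
End TwoStep.

Section Zonal.
Variables (R : realFieldType) (n : nat) (n_gt1 : (1 < n)%N).

(* The three-term recurrence of the Gegenbauer polynomials normalized to 1 at 1.
   It starts at degree 1, since its first instance is void for n = 2. *)
Definition gegen : nat -> {poly R} := two_step 1 'X
  (fun l x y => (l + n.-1)%:R^-1 *:
     ((l.*2 + n)%:R *: ('X * y) - l.+1%:R *: x)).

(* The homogeneous form of [gegen] with pole s; harmonicity comes from the
   relation d_s P_{l+1} = (l + 1) P_l, proved along the way. *)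
Definition zonal (s : 'I_n -> R) : nat -> {mpoly R[n]} :=
  two_step 1 (linear_form s)
  (fun l x y => (l + n.-1)%:R^-1 *:
     ((l.*2 + n)%:R *: (linear_form s * y) - l.+1%:R *: (sqr_norm R n * x))).

Let den_neq0 l : (l + n.-1)%:R != 0 :> R.
Proof. by rewrite pnatr_eq0; lia. Qed.

Lemma gegen1 l : (gegen l).[1] = 1.
Proof.
apply: (two_step_ind (P := fun _ x => x.[1] = 1)); rewrite ?hornerE // => k x y hx hy.
rewrite hornerE hornerD hornerN !hornerZ hornerM hornerX hx hy !mulr1.
apply: (mulfI (den_neq0 k)); rewrite mulVKf // mulr1 -natrB; last lia.
by congr _%:R; lia.
Qed.

Lemma size_gegen l : size (gegen l) = l.+1.
Proof.
apply: (two_step_ind (P := fun l (x : {poly R}) => size x = l.+1)) => [||k x y hx hy].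
- by rewrite size_poly1.
- by rewrite size_polyX.
have y0 : y != 0 by rewrite -size_poly_eq0 hy.
have c0 : (k.*2 + n)%:R != 0 :> R by rewrite pnatr_eq0; lia.
have sXy : size ((k.*2 + n)%:R *: ('X * y)) = k.+3.
  by rewrite size_scale // mulrC size_mulX // hy.
rewrite size_scale ?invr_eq0 // size_polyDl ?sXy // size_polyN.
by rewrite (leq_ltn_trans (size_scale_leq _ _)) // hx.
Qed.

Variable s : 'I_n -> R.
Hypothesis s1 : \sum_i s i ^+ 2 = 1.
Local Notation P := (zonal s).
Local Notation u := (linear_form s).
Local Notation rho := (sqr_norm R n).

Lemma meval_zonal v l : \sum_i v i ^+ 2 = 1 ->
  (P l).@[v] = (gegen l).[\sum_i s i * v i].
Proof.
move=> v1; have hu := meval_linear_form s v.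
have hr : rho.@[v] = 1.
  rewrite raddf_sum -[RHS]v1; apply: eq_bigr => i _ /=.
  by rewrite rmorphXn /= mevalXU.
suff: (P l).@[v] = (gegen l).[\sum_i s i * v i] /\
      (P l.+1).@[v] = (gegen l.+1).[\sum_i s i * v i] by case.
elim: l => [|l [IH1 IH2]]; first by rewrite /= meval1 hu hornerX hornerE.
split=> //; rewrite /P /gegen !two_stepSS -/P -/gegen.
rewrite mevalZ mevalB !mevalZ !mevalM hu hr IH1 IH2.
by rewrite hornerZ hornerD hornerN !hornerZ hornerM hornerX mul1r.
Qed.

(** The four claims need each other. The fourth rewrites [rho * directional s (P l)] without a
    derivative, which is what the derivative of the recurrence requires to give the third claim in
    the next degree. In turn the fourth claim in the next degree is the recurrence itself, once the
    third is substituted. *)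
Lemma zonal_spec l :
  [/\ harmonic l (P l), harmonic l.+1 (P l.+1),
      directional s (P l.+1) = l.+1%:R *: P l &
      (l + n - 2)%:R *: P l.+1 =
        (l.*2 + n - 2)%:R *: (u * P l) - rho * directional s (P l)].
Proof.
elim: l => [|l [h0 h1 h2 h3]].
  have d1 i : (1 : {mpoly R[n]})^`M(i) = 0 by rewrite -(@mpolyC1 n R) mderivC.
  split.
  - split; first exact: dhomog1.
    by rewrite big1 // => i _; rewrite d1 mderiv0.
  - by split; [exact: linear_form_homog|exact: laplacian_linear_form].
  - rewrite directional_linear_form scale1r -[RHS](@mpolyC1 n R) -s1.
    by congr _%:MP; apply: eq_bigr => i _; rewrite expr2.
  - rewrite /directional big1 => [|i _]; last by rewrite d1 scaler0.
    by rewrite mulr0 subr0 /zonal /two_step /= mulr1 double0 add0n.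
have E : (l + n.-1)%:R *: P l.+2 =
    (l.*2 + n)%:R *: (u * P l.+1) - l.+1%:R *: (rho * P l).
  by rewrite [P l.+2]two_stepSS scalerA divff // scale1r.
have Du : directional s u = 1.
  rewrite directional_linear_form -(@mpolyC1 n R) -s1.
  by congr _%:MP; apply: eq_bigr => i _; rewrite expr2.
split=> //.
- split.
    rewrite /zonal two_stepSS -/P; apply: rpredZ; apply: rpredB; apply: rpredZ.
      by have := dhomogM (linear_form_homog s) h1.1; rewrite add1n.
    by have := dhomogM (sqr_norm_homog R n) h0.1; rewrite add2n.
  (* Here [u * P l.+1] contributes 2 (l + 1) P_l by the third claim, and [rho * P l] contributes (2
     n + 4 l) P_l by Euler's identity. With the coefficients 2 l + n and l + 1 the two cancel. *)
  apply: (scalerI (den_neq0 l)); rewrite scaler0 -/(laplacian _) -linearZ /= E.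
  rewrite linearB !linearZ /= !laplacianM laplacian_linear_form.
  rewrite [laplacian (P l)]h0.2 [laplacian (P l.+1)]h1.2 laplacian_sqr_norm.
  rewrite grad_linear_form h2 mul0r !mulr0 !addr0 add0r.
  rewrite (eq_bigr (fun i => ('X_i * (P l)^`M(i)) *+ 2)) => [|i _]; last first.
    by rewrite mderiv_sqr_norm mulrnAl.
  rewrite sumrMnl (euler_homog h0.1) -!mul_mpolyC !rmorph_nat -muln2.
  by move: (P l) => a; ring.
- apply: (scalerI (den_neq0 l)); rewrite -linearZ /= E linearB !linearZ /=.
  rewrite !directionalM Du directional_sqr_norm h2 mul1r -scalerAr.
  have -> : rho * directional s (P l) =
      (l.*2 + n - 2)%:R *: (u * P l) - (l + n - 2)%:R *: P l.+1.
    by rewrite h3 subKr.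
  rewrite mulrnAl -scaler_nat.
  have -> : (l.*2 + n - 2)%:R = l%:R *+ 2 + n%:R - 2 :> R.
    by rewrite natrB ?natrD -?mul2n ?natrM; [ring|lia].
  have -> : (l + n - 2)%:R = l%:R + n%:R - 2 :> R by rewrite natrB ?natrD //; lia.
  have -> : (l + n.-1)%:R = l%:R + n%:R - 1 :> R.
    by rewrite -subn1 addnBA ?natrB ?natrD //; lia.
  rewrite -mul2n natrD natrM -(natr1 l.+1) -(natr1 l).
  rewrite -!mul_mpolyC; move: (u * P l) (P l.+1) => a b.
  rewrite !(rmorphD, rmorphB, rmorphM, rmorphN, rmorph1, rmorph_nat, rmorphMn) /=.
  ring.
- rewrite h2 -scalerAr.
  have -> : (l.+1 + n - 2 = l + n.-1)%N by lia.
  by have -> : (l.+1.*2 + n - 2 = l.*2 + n)%N by lia.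
Qed.

Lemma harmonic_zonal l : harmonic l (P l).
Proof. by case: (zonal_spec l). Qed.

End Zonal.

(** * Transfer to an integral over points given by coordinates *)

Section Restriction.
Variables (R : realFieldType) (n : nat) (n_gt1 : (1 < n)%N).
Variables (T : Type) (v : T -> 'I_n -> R) (J : (T -> R) -> R).
Local Notation mono := (monomial_fun v).

Hypothesis J_linear : forall s : seq (R * ('I_n -> nat)),
  J (fun t => \sum_(p <- s) p.1 * mono p.2 t) = \sum_(p <- s) p.1 * J (mono p.2).

(** The Laplacian identity on a monomial. Truncated subtraction of 2 is harmless, since the
    coefficient vanishes for an exponent below 2. *)
Hypothesis J_moments : forall a : 'I_n -> nat,
  \sum_i (a i * (a i).-1)%:R * J (mono (fun j => a j - (j == i).*2)%N) =
  ((\sum_i a i) * (\sum_i a i + n - 2))%:R * J (mono a).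

Definition restricted_functional (p : {mpoly R[n]}) : R := J (fun t => p.@[v t]).
Local Notation I := restricted_functional.

Lemma restricted_functionalE p :
  I p = \sum_(m <- msupp p) p@_m * J (mono (fun i => m i)).
Proof.
pose s := [seq (p@_m, (fun i => m i) : 'I_n -> nat) | m <- msupp p].
transitivity (\sum_(x <- s) x.1 * J (mono x.2)); last by rewrite big_map.
rewrite -J_linear; congr (J _); apply: boolp.funext => t.
by rewrite mevalE [RHS]big_map.
Qed.

Lemma restricted_functional_is_scalar : scalar I.
Proof.
move=> a p q.
pose s := [seq (a * p@_m, (fun i => m i) : 'I_n -> nat) | m <- msupp p] ++
          [seq (q@_m, (fun i => m i) : 'I_n -> nat) | m <- msupp q].
have -> : I (a *: p + q) = J (fun t => \sum_(x <- s) x.1 * mono x.2 t).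
  congr (J _); apply: boolp.funext => t; rewrite big_cat mevalD mevalZ.
  rewrite !mevalE mulr_sumr; congr (_ + _); last by rewrite [RHS]big_map.
  by rewrite [RHS]big_map; apply: eq_bigr => m _; rewrite /= mulrA.
rewrite J_linear big_cat !restricted_functionalE mulr_sumr; congr (_ + _).
  by rewrite [LHS]big_map; apply: eq_bigr => m _; rewrite /= mulrA.
by rewrite [LHS]big_map.
Qed.
HB.instance Definition _ :=
  GRing.isLinear.Build R {mpoly R[n]} R *%R I restricted_functional_is_scalar.

Lemma restricted_functional_laplacian d p : p \is d.-homog ->
  I (laplacian p) = (d * (d + n - 2))%:R * I p.
Proof.
move=> hp; have IX m : I 'X_[m] = J (mono (fun i => m i)).
  by congr (J _); apply: boolp.funext => t; rewrite mevalX.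
rewrite {1}[p]mpolyE [in RHS]restricted_functionalE.
rewrite [laplacian _]linear_sum linear_sum mulr_sumr !big_seq.
apply: eq_bigr => m hm; rewrite !linearZ /= mulrCA; congr (_ * _).
have := dhomog_mf hp hm; rewrite /= mdegE => <-; rewrite -J_moments.
rewrite linear_sum; apply: eq_bigr => i _.
rewrite mderivX linearZ /= mderivX scalerA linearZ /= IX -natrM.
rewrite mnmBE mnm1E eqxx subn1; congr (_ * J (monomial_fun _ _)).
apply: boolp.funext => j; rewrite !mnmBE !mnm1E eq_sym -subnDA.
by rewrite addnn.
Qed.

Lemma harmonic_restriction_poly l Y : harmonic_restriction l v Y ->
  is_polyfun v Y.
Proof.
move=> [p _ hY]; exists [seq (p@_m, (fun i => m i) : 'I_n -> nat) | m <- msupp p].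
by move=> t; rewrite hY mevalE [RHS]big_map.
Qed.

Lemma harmonic_restriction_orthogonal l m Y Z :
  harmonic_restriction l v Y -> harmonic_restriction m v Z -> l != m ->
  J (fun t => Y t * Z t) = 0.
Proof.
move=> [p hp hY] [q hq hZ] lm.
have -> : (fun t => Y t * Z t) = (fun t => (p * q).@[v t]).
  by apply: boolp.funext => t; rewrite mevalM hY hZ.
have orth := harmonic_orthogonal n_gt1 restricted_functional_laplacian.
move: lm; rewrite neq_ltn => /orP[lm|lm]; first exact: orth lm hp hq.
by rewrite mulrC; apply: orth lm hq hp.
Qed.

Lemma funk_hecke_restriction l (g : {poly R}) : (size g <= l.+1)%N ->
  exists kappa : R, forall Y t, harmonic_restriction l v Y ->
    J (fun s => g.[\sum_i v t i * v s i] * Y s) = kappa * Y t.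
Proof.
move=> sg; have [k hk] := funk_hecke n_gt1 restricted_functional_laplacian sg.
exists k => Y t [q hq hY]; rewrite hY -hk //; congr (J _).
apply: boolp.funext => s; rewrite mevalM hY; congr (_ * _).
rewrite raddf_sum (horner_coef_wide _ sg); apply: eq_bigr => j _ /=.
by rewrite mevalZ rmorphXn /= meval_linear_form.
Qed.

Lemma zonal_restriction (s : 'I_n -> R) l : \sum_i s i ^+ 2 = 1 ->
  (forall t, \sum_i v t i ^+ 2 = 1) ->
  harmonic_restriction l v (fun t => (gegen R n l).[\sum_i s i * v t i]).
Proof.
move=> s1 v1; exists (zonal s l); first exact: harmonic_zonal.
by move=> t; rewrite meval_zonal.
Qed.

Lemma harmonic_restriction0 Y : harmonic_restriction 0 v Y ->
  exists c, forall t, Y t = c.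
Proof.
move=> [p [hp _] hY]; exists p@_0%MM => t; rewrite hY {1}(homog0_const hp).
exact: mevalC.
Qed.

Lemma harmonic_restriction_cst (c : R) : harmonic_restriction 0 v (fun=> c).
Proof.
exists c%:MP => [|t]; last by rewrite mevalC.
split; first by rewrite -alg_mpolyC rpredZ // dhomog1.
by rewrite big1 // => i _; rewrite mderivC mderiv0.
Qed.

End Restriction.

End ZonalHarmonics.

From mathcomp Require Import all_classical all_reals all_analysis.
From mathcomp Require Import measurable_realfun.

Import Order.TTheory GRing.Theory Num.Theory.
Import numFieldNormedType.Exports.

Local Open Scope classical_set_scope.
Local Open Scope ring_scope.

(** * Integration of polynomials over the sphere *)

Section TrigonometricMoments.
Variable R : realType.
Notation mu := (@lebesgue_measure R).

Lemma continuous_itv_integrable (f : R -> R) a b :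
  continuous f -> mu.-integrable `[a, b] (EFin \o f).
Proof.
move=> cf; apply: continuous_compact_integrable; first exact: segment_compact.
exact: continuous_subspaceT.
Qed.

Lemma Rintegral_derive (F f : R -> R) (a b : R) : a < b ->
  (forall x : R, is_derive x (1 : R) F (f x)) -> continuous f ->
  \int[mu]_(x in `[a, b]) f x = F b - F a.
Proof.
move=> ab dF cf.
have cF : continuous F.
  move=> x; apply: differentiable_continuous; apply/derivable1_diffP.
  exact: (@ex_derive _ _ _ _ _ _ _ (dF x)).
rewrite /Rintegral (@continuous_FTC2 _ f F) //; first exact: continuous_subspaceT.
- split=> [x _||]; first exact: (@ex_derive _ _ _ _ _ _ _ (dF x)).
    exact: cvg_at_right_filter (cF a).
  exact: cvg_at_left_filter (cF b).
- by move=> x _; rewrite derive1E; apply: (@derive_val _ _ _ _ _ _ _ (dF x)).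
Qed.

Lemma continuous_cos_sin a b : continuous (fun x : R => cos x ^+ a * sin x ^+ b).
Proof.
have cX (f : R -> R) n : continuous f -> continuous (fun x => f x ^+ n).
  by move=> cf x; apply: (@continuous_comp _ _ _ f (fun y => y ^+ n));
     [exact: cf|exact: exprn_continuous].
by move=> x; apply: cvgM; apply: cX; [exact: continuous_cos|exact: continuous_sin].
Qed.

Definition trig_moment (a b : nat) : R :=
  \int[mu]_(x in `[0, pi]) (cos x ^+ a * sin x ^+ b).
Local Notation J := trig_moment.

Lemma trig_momentD (a b a' b' : nat) (c c' : R) :
  \int[mu]_(x in `[0, pi]) (c * (cos x ^+ a * sin x ^+ b) +
                            c' * (cos x ^+ a' * sin x ^+ b')) =
  c * J a b + c' * J a' b'.
Proof.
have h a0 b0 (c0 : R) :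
    mu.-integrable `[0, pi] (EFin \o (fun x => c0 * (cos x ^+ a0 * sin x ^+ b0))).
  apply: continuous_itv_integrable => x.
  by apply: cvgM; [exact: cvg_cst|exact: continuous_cos_sin].
rewrite RintegralD // !RintegralZl //; exact/continuous_itv_integrable/continuous_cos_sin.
Qed.

Lemma trig_moment_cos2D a b : J a.+2 b + J a b.+2 = J a b.
Proof.
rewrite -[J a.+2 b]mul1r -[J a b.+2]mul1r -trig_momentD; apply: eq_Rintegral => x _.
rewrite !mul1r !exprSr -!mulrA; have := cos2Dsin2 x; rewrite !expr2 => h.
by rewrite -[RHS]mul1r -h; ring.
Qed.

(** The difference of the two integrands is the derivative of cos^(a+1) sin^(b+1), which vanishes at
    0 and at pi. *)
Lemma trig_moment_by_parts a b : b.+1%:R * J a.+2 b = a.+1%:R * J a b.+2.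
Proof.
apply/eqP; rewrite -subr_eq0 -mulNr -trig_momentD.
pose F : R -> R := cos ^+ a.+1 * sin ^+ b.+1.
apply/eqP; transitivity (F pi - F 0); last first.
  by rewrite /F !mulrfctE !exprfctE sinpi sin0 !expr0n /= !mulr0 subrr.
apply: Rintegral_derive; first exact: pi_gt0.
- move=> x; apply: is_derive_eq.
  by rewrite !exprfctE /GRing.scale /= !exprS; ring.
- move=> x; apply: cvgD; apply: cvgM; (try exact: cvg_cst); exact: continuous_cos_sin.
Qed.

Lemma trig_moment1 b : J 1 b = 0.
Proof.
apply: (@mulfI _ b.+1%:R); first by rewrite pnatr_eq0.
(* The void summand [0 * J 0 0] gives the expression the two-term shape expected by
   [trig_momentD]. *)
rewrite mulr0 -[LHS]addr0 -(mul0r (J 0 0)) -trig_momentD.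
pose F : R -> R := sin ^+ b.+1.
transitivity (F pi - F 0); last by rewrite /F !exprfctE sinpi sin0 mul0r subrr.
apply: Rintegral_derive; first exact: pi_gt0.
- move=> x; apply: is_derive_eq.
  by rewrite ?exprfctE /GRing.scale /=; ring.
- move=> x; apply: cvgD; apply: cvgM; (try exact: cvg_cst); exact: continuous_cos_sin.
Qed.

(** The factor [a] is kept on both sides so that no lower bound on [a] is required; for [a = 1] the
    right-hand side is zero by [trig_moment1]. *)
Lemma trig_moment_lower_cos a b :
  (a * a.-1)%:R * J a.-2 b = (a * (b + a))%:R * J a b.
Proof.
case: a => [|[|a]]; rewrite ?mul0n ?mul0r // ?muln0 ?mul0r ?trig_moment1 ?mulr0 //=.
rewrite -(trig_moment_cos2D a b) !natrM -!mulrA; congr (_ * _).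
by rewrite mulrDr -trig_moment_by_parts; ring.
Qed.

Lemma trig_moment_lower_sin a b :
  b.+1%:R * J a b = (b.+2 + a)%:R * J a b.+2.
Proof.
by rewrite -(trig_moment_cos2D a b) mulrDr trig_moment_by_parts; ring.
Qed.
End TrigonometricMoments.

(** * Moments of the surface measure *)

Section SphereMoments.
Variable R : realType.
Notation mu := (@lebesgue_measure R).
Local Notation J := (@trig_moment R).

Lemma trig_moment_sum (s : seq (R * (nat * nat))) :
  \int[mu]_(x in `[0, pi]) (\sum_(p <- s) p.1 * (cos x ^+ p.2.1 * sin x ^+ p.2.2)) =
  \sum_(p <- s) p.1 * J p.2.1 p.2.2.
Proof.
have cF p : continuous (fun x : R => p.1 * (cos x ^+ p.2.1 * sin x ^+ p.2.2)).
  by move=> x; apply: cvgM; [exact: cvg_cst|exact: continuous_cos_sin].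
have cS (s' : seq (R * (nat * nat))) : continuous
    (fun x : R => \sum_(p <- s') p.1 * (cos x ^+ p.2.1 * sin x ^+ p.2.2)).
  elim: s' => [|p s' IH] x.
    by under eq_fun do rewrite big_nil; exact: cvg_cst.
  by under eq_fun do rewrite big_cons; apply: cvgD; [exact: cF|exact: IH].
elim: s => [|p s IH].
  by under eq_Rintegral do rewrite big_nil; rewrite big_nil Rintegral_cst ?mul0r.
under eq_Rintegral do rewrite big_cons.
rewrite RintegralD //; last 2 first.
- by apply: continuous_itv_integrable; exact: cF.
- by apply: continuous_itv_integrable; exact: cS.
rewrite big_cons IH RintegralZl //.
exact/continuous_itv_integrable/continuous_cos_sin.
Qed.

Definition coords n (t : sphere R n) (i : 'I_n) : R := \val t i 0.
Arguments coords {n}.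
Local Notation mono := (monomial_fun coords).

Lemma coords_sph0 n phi (w : sphere R n.+1) : coords (sph phi w) ord0 = cos phi.
Proof.
have E : ord0 = lshift n.+1 (ord0 : 'I_1) by apply: val_inj.
rewrite /coords E; apply: etrans (col_mxEu _ _ _ _) _.
by rewrite mxE eqxx.
Qed.

Lemma coords_sphS n phi (w : sphere R n.+1) i :
  coords (sph phi w) (lift ord0 i) = sin phi * coords w i.
Proof.
have E : lift ord0 i = rshift 1 i by apply: val_inj.
rewrite /coords E; apply: etrans (col_mxEd _ _ _ _) _.
by rewrite mxE.
Qed.

Lemma sphere_integralSS n (f : sphere R n.+2 -> R) : sphere_integral f =
  \int[mu]_(x in `[0, pi]) (sin x ^+ n * sphere_integral (fun w => f (sph x w))).
Proof. by []. Qed.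

Lemma monomial_sph n (a : 'I_n.+2 -> nat) phi (w : sphere R n.+1) :
  mono a (sph phi w) =
  cos phi ^+ a ord0 * sin phi ^+ (\sum_i a (lift ord0 i)) *
  mono (fun i => a (lift ord0 i)) w.
Proof.
rewrite /monomial_fun big_ord_recl coords_sph0 -mulrA; congr (_ * _).
rewrite expr_sum -big_split; apply: eq_bigr => i _ /=.
by rewrite coords_sphS exprMn.
Qed.

(** Additivity of the integral in [phi] requires integrability, so the inner integral is made
    explicit first: on a monomial it is a constant times a power of sine and a power of cosine.
    Linearity in the previous dimension is what extracts these constants. *)
Lemma sphere_integral_linear n (s : seq (R * ('I_n -> nat))) :
  sphere_integral (fun t => \sum_(p <- s) p.1 * mono p.2 t) =
  \sum_(p <- s) p.1 * sphere_integral (mono p.2).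
Proof.
case: n s => [|n] s; first by rewrite /= big1 // => p _; rewrite mulr0.
elim: n s => [|n IH] s.
  by rewrite /= -big_split; apply: eq_bigr => p _; rewrite mulrDr.
have IH1 c a : sphere_integral (fun w : sphere R n.+1 => c * mono a w) =
    c * sphere_integral (mono a).
  have := IH [:: (c, a)]; rewrite big_seq1 => <-; congr sphere_integral.
  by apply/funext => t; rewrite big_seq1.
pose b (a : 'I_n.+2 -> nat) := (n + \sum_i a (lift ord0 i))%N.
pose I' (a : 'I_n.+2 -> nat) :=
  sphere_integral (mono (fun i => a (lift ord0 i)) : sphere R n.+1 -> R).
have E a : sphere_integral (mono a : sphere R n.+2 -> R) = I' a * J (a ord0) (b a).
  rewrite sphere_integralSS -RintegralZl //; last exact/continuous_itv_integrable/continuous_cos_sin.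
  apply: eq_Rintegral => phi _.
  under [X in sphere_integral X]eq_fun do rewrite monomial_sph.
  rewrite IH1 exprD -/(I' a); ring.
transitivity (\sum_(q <- [seq (p.1 * I' p.2, (p.2 ord0, b p.2)) | p <- s])
   q.1 * J q.2.1 q.2.2); last first.
  by rewrite big_map; apply: eq_bigr => p _; rewrite E mulrA.
rewrite sphere_integralSS -trig_moment_sum; apply: eq_Rintegral => phi _; rewrite big_map.
set f := (X in sphere_integral X).
have -> : f = fun w : sphere R n.+1 => \sum_(q <- [seq (p.1 *
    (cos phi ^+ p.2 ord0 * sin phi ^+ (\sum_i p.2 (lift ord0 i))),
    (fun i => p.2 (lift ord0 i)) : 'I_n.+1 -> nat) | p <- s]) q.1 * mono q.2 w.
  apply/funext => w; rewrite big_map; apply: eq_bigr => p _.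
  by rewrite monomial_sph !mulrA.
rewrite IH big_map mulr_sumr; apply: eq_bigr => p _.
rewrite -[X in _ * (_ * X)]/(I' p.2) [RHS]/= exprD /=; ring.
Qed.

Lemma sphere_integral_scale n (c : R) (a : 'I_n -> nat) :
  sphere_integral (fun t => c * mono a t) = c * sphere_integral (mono a).
Proof.
have := sphere_integral_linear [:: (c, a)]; rewrite big_seq1 => <-.
by congr sphere_integral; apply/funext => t; rewrite big_seq1.
Qed.

Lemma sphere_integral_monomial n (a : 'I_n.+2 -> nat) :
  sphere_integral (mono a) = J (a ord0) (n + \sum_i a (lift ord0 i)) *
    sphere_integral (mono (fun i => a (lift ord0 i)) : sphere R n.+1 -> R).
Proof.
rewrite sphere_integralSS mulrC -RintegralZl //;
  last exact/continuous_itv_integrable/continuous_cos_sin.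
apply: eq_Rintegral => phi _.
under [X in sphere_integral X]eq_fun do rewrite monomial_sph.
by rewrite sphere_integral_scale exprD; move: (sphere_integral _) => S; ring.
Qed.

Lemma sphere_integral1 (a : 'I_1 -> nat) :
  sphere_integral (mono a) = 1 + (-1) ^+ a ord0.
Proof.
by rewrite /= /monomial_fun !big_ord1 /coords /= !mxE eqxx !mulr1n expr0 expr1 expr1n.
Qed.

(** By induction on the dimension. Splitting off the first coordinate factors each integral into a
    trigonometric moment and an integral over the lower sphere. The summand of index 0 is handled by
    [trig_moment_lower_cos], the others by the induction hypothesis and [trig_moment_lower_sin];
    they give a_0 (a_0 + b + n) and b (a_0 + b + n) times the same integral. *)
Lemma sphere_moments n (a : 'I_n.+1 -> nat) :
  \sum_i (a i * (a i).-1)%:R *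
    sphere_integral (mono (fun j => a j - (j == i).*2)%N) =
  ((\sum_i a i) * (\sum_i a i + n.+1 - 2))%:R * sphere_integral (mono a).
Proof.
elim: n a => [|n IH] a.
  rewrite !big_ord1 !sphere_integral1 eqxx /=.
  case: (a ord0) => [|[|k]]; first by rewrite !mul0r.
    by rewrite muln0 expr1 subrr mul0r mulr0.
  by rewrite addn1 2!subSS subn0 subn2 /= [in RHS]exprS exprS mulrA mulrNN !mul1r.
pose a' i := a (lift ord0 i); pose b := (\sum_i a' i)%N.
have dE : (\sum_i a i = a ord0 + b)%N by rewrite big_ord_recl.
pose S' := sphere_integral (mono a' : sphere R n.+1 -> R).
have E0 : sphere_integral (mono (fun j => a j - (j == ord0).*2)%N : sphere R n.+2 -> R) =
    J (a ord0).-2 (n + b) * S'.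
  rewrite sphere_integral_monomial eqxx subn2; congr (J _ _ * _).
    by congr addn; apply: eq_bigr => i _; rewrite /= subn0.
  by congr (sphere_integral (monomial_fun _ _)); apply/funext => i; rewrite /= subn0.
have ES i : (a' i * (a' i).-1)%:R * sphere_integral
      (mono (fun j => a j - (j == lift ord0 i).*2)%N : sphere R n.+2 -> R) =
    J (a ord0) (n + b - 2) * ((a' i * (a' i).-1)%:R *
      sphere_integral (mono (fun j => a' j - (j == i).*2)%N : sphere R n.+1 -> R)).
  (* Either the coefficient is zero, or the exponent is at least 2 and [n + b - 2] is a genuine
     subtraction. *)
  case: (leqP (a' i) 1) => [ai|ai].
    have -> : (a' i * (a' i).-1 = 0)%N by case: (a' i) ai => [|[|]].
    by rewrite !mul0r mulr0.
  rewrite mulrCA; congr (_ * _); rewrite sphere_integral_monomial.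
  rewrite [in J _ _]/= subn0; congr (J _ _ * _).
  have bE : (b = a' i + \sum_(j | j != i) a' j)%N by rewrite /b (bigD1 i).
  rewrite -addnBA; last by rewrite bE (leq_trans ai) // leq_addr.
  rewrite bE -addnBAC // (bigD1 i) //= eqxx; congr (_ + (_ + _))%N.
  by apply: eq_bigr => j ji; rewrite (inj_eq lift_inj) (negPf ji) subn0.
rewrite big_ord_recl dE E0 (eq_bigr _ (fun i _ => ES i)) -mulr_sumr IH.
rewrite sphere_integral_monomial -/a' -/S' -/b mulrA trig_moment_lower_cos.
(* When [n + b] is at most 1, [n + b - 2] is truncated and the sine formula does not apply. Then
   [b = 0] and the extra terms vanish, or [n = 0] and [b = 1], where the integral over the two
   points of S^0 is zero. *)
have [b1|b2] := leqP (n + b) 1; last first.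
  have -> : (b + n.+1 - 2 = (n + b - 2).+1)%N by lia.
  have := trig_moment_lower_sin R (a ord0) (n + b - 2).
  have -> : (n + b - 2).+2 = (n + b)%N by lia.
  have -> : (a ord0 + b + n.+2 - 2 = a ord0 + b + n)%N by lia.
  move: (S') (J _ (n + b - 2)) (J _ (n + b)) (n + b - 2).+1 => S j j' k L.
  have -> : j * ((b * k)%:R * S) = b%:R * (k%:R * j) * S by rewrite natrM; ring.
  by rewrite L; ring.
have [->|b0] := eqVneq b 0%N.
  rewrite mul0n mul0r mulr0 addr0 !addn0 mulrA.
  by have -> : (a ord0 + n.+2 - 2 = n + a ord0)%N by lia.
have [n0 b1'] : n = 0%N /\ b = 1%N by lia.
have Z k (c : 'I_k.+1 -> nat) : k = 0%N -> (\sum_i c i = 1)%N ->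
    sphere_integral (mono c) = 0.
  move=> k0; subst k; rewrite big_ord1 sphere_integral1 => ->.
  by rewrite expr1 subrr.
by rewrite /S' Z // !mulr0 addr0.
Qed.

Lemma sphere_integral_ge0 n (f : sphere R n -> R) :
  (forall t, 0 <= f t) -> 0 <= sphere_integral f.
Proof.
case: n f => [|n] // f; elim: n f => [|n IH] f f0; first by rewrite addr_ge0.
rewrite sphere_integralSS; apply: Rintegral_ge0 => phi /=; rewrite in_itv /= => hphi.
by rewrite mulr_ge0 ?exprn_ge0 ?sin_ge0_pi ?hphi //; apply: IH.
Qed.

Lemma sphere_integral_cst n (c : R) :
  sphere_integral (fun _ : sphere R n.+1 => c) = c * sphere_area R n.
Proof.
have E : mono (fun _ : 'I_n.+1 => 0%N) = fun=> 1.
  by apply/funext => t; rewrite /monomial_fun big1.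
have := sphere_integral_scale c (fun _ : 'I_n.+1 => 0%N).
by rewrite E => <-; congr sphere_integral; apply/funext => t; rewrite mulr1.
Qed.

(** In dimension N = n + 2 the factor [sphere_area R n] is |S^(N-2)|: this is the source of that
    constant in the weights of the norm. *)
Lemma sphere_integral_zonal n (g : R -> R) : continuous g ->
  sphere_integral (fun t : sphere R n.+2 => g (coords t ord0)) =
  sphere_area R n * \int[mu]_(x in `[0, pi]) (sin x ^+ n * g (cos x)).
Proof.
move=> cg; rewrite sphere_integralSS -RintegralZl //; last first.
  apply: continuous_itv_integrable => x; apply: cvgM.
    by apply: (@continuous_comp _ _ _ sin (fun y => y ^+ n));
       [exact: continuous_sin|exact: exprn_continuous].
  by apply: (@continuous_comp _ _ _ cos g); [exact: continuous_cos|exact: cg].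
apply: eq_Rintegral => x _.
under [X in sphere_integral X]eq_fun do rewrite coords_sph0.
by rewrite sphere_integral_cst; ring.
Qed.

End SphereMoments.
Arguments sphere_integral : simpl never.

(** * Gegenbauer polynomials and the addition theorem *)

Section GegenbauerIntegral.
Variables (R : realType) (m : nat).
Notation mu := (@lebesgue_measure R).
Let e : R := m.+2%:R / 2 - 1 - 2^-1.
Let w (s : R) := (1 - s ^+ 2) `^ e.

Lemma weight_cos x : 0 < x < pi -> w (cos x) * sin x = sin x ^+ m.
Proof.
move=> hx; have s0 : 0 < sin x by apply: sin_gt0_pi.
rewrite /w -(cos2Dsin2 x) addrAC subrr add0r -powR_mulrn ?ltW // -powRrM.
rewrite -{2}(powRr1 (ltW s0)) -powRD; last by rewrite (gt_eqF s0) implybT.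
have -> : 2 * e + 1 = m%:R by rewrite /e -[m.+2]addn2 natrD; field.
by rewrite powR_mulrn // ltW.
Qed.

Lemma weight_ge0 s : 0 <= w s. Proof. exact: powR_ge0. Qed.

Lemma continuous_weight (s : R) : -1 < s < 1 -> {for s, continuous w}.
Proof.
move=> /andP[s1 s2].
change {for s, continuous ((fun y : R => y `^ e) \o (fun s : R => 1 - s ^+ 2))}.
apply: continuous_comp.
  by apply: cvgB; [exact: cvg_cst|exact: exprn_continuous].
apply: differentiable_continuous; apply/derivable1_diffP.
by apply: derivable_powR; rewrite in_itv /= andbT; nra.
Qed.

(** The shift by 2 keeps [d k] at most [pi / 2], so that [d k <= pi - d k] for every [k]. *)
Let d (k : nat) : R := pi / k.+2%:R.

Lemma itv_exhaust_gt0 k : 0 < d k <= pi / 2.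
Proof.
rewrite divr_gt0 ?pi_gt0 //= ler_pM2l ?pi_gt0 //.
by rewrite lef_pV2 ?posrE // ler_nat.
Qed.

Lemma itv_exhaust_le k l : (k <= l)%N -> d l <= d k.
Proof.
by move=> kl; rewrite ler_pM2l ?pi_gt0 // lef_pV2 ?posrE // ler_nat.
Qed.

Lemma itv_exhaust x : 0 < x < pi -> exists k, d k <= x <= pi - d k.
Proof.
move=> /andP[x0 x1]; pose y := Num.min x (pi - x).
have y0 : 0 < y by rewrite lt_min x0 subr_gt0.
exists (Num.truncn (pi / y)).
have h : d (Num.truncn (pi / y)) <= y.
  rewrite ler_pdivrMr // mulrC -ler_pdivrMr //.
  by rewrite (le_trans (ltW (truncnS_gt _))) // ler_nat.
have : y <= x by rewrite ge_min lexx.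
have : y <= pi - x by rewrite ge_min lexx orbT.
by move: h; set dd := d _ => *; apply/andP; split; lra.
Qed.

(* The weight is unbounded near -1 and 1 when m = 0, so the substitution
   s = cos x is performed on compact subintervals exhausting the domain. *)
Let A k : set R := `[d k, pi - d k].
Let B k : set R := `[cos (pi - d k), cos (d k)].

Lemma nondecreasing_angles : nondecreasing_seq A.
Proof.
move=> k l kl; rewrite subsetEset => x; rewrite /A /B /= !in_itv /= => /andP[h1 h2].
by have := itv_exhaust_le kl => ?; apply/andP; split; lra.
Qed.

Lemma bigcup_angles : \bigcup_k A k = `]0, pi[%classic.
Proof.
apply/seteqP; split => x /=.
  move=> [k _]; rewrite ?/A ?/B /= !in_itv /= => /andP[h1 h2].
  by have /andP[? ?] := itv_exhaust_gt0 k; apply/andP; split; lra.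
by rewrite in_itv /= => /itv_exhaust[k hk]; exists k => //=; rewrite in_itv.
Qed.

Let in_angle k : d k \in `[0, pi] /\ pi - d k \in `[0, pi].
Proof.
have /andP[? ?] := itv_exhaust_gt0 k; have := pi_gt0 R.
by rewrite !in_itv /=; split; apply/andP; split; lra.
Qed.

Let cos_le (x y : R) : x \in `[0, pi] -> y \in `[0, pi] -> x <= y -> cos y <= cos x.
Proof. by move=> hx hy xy; rewrite leNgt ltr_cos // -leNgt. Qed.

Lemma nondecreasing_cosines : nondecreasing_seq B.
Proof.
move=> k l kl; rewrite subsetEset => x; rewrite /A /B /= !in_itv /= => /andP[h1 h2].
have dl := itv_exhaust_le kl; have [? ?] := in_angle k; have [? ?] := in_angle l.
apply/andP; split.
  by apply: le_trans h1; apply: cos_le => //; rewrite lerB.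
by apply: le_trans h2 _; apply: cos_le.
Qed.

Let cos_bnd (x : R) : 0 < x < pi -> -1 < cos x < 1.
Proof.
move=> /andP[x0 x1]; rewrite -cospi -cos0 !ltr_cos ?x0 ?x1 //;
  by rewrite in_itv /= ?lexx ?pi_ge0 ?ltW.
Qed.

Lemma bigcup_cosines : \bigcup_k B k = `]-1, 1[%classic.
Proof.
apply/seteqP; split => x /=.
  move=> [k _]; rewrite ?/A ?/B /= !in_itv /= => /andP[h1 h2].
  have /andP[? ?] := itv_exhaust_gt0 k; have := pi_gt0 R => ?.
  have /andP[? _] : -1 < cos (pi - d k) < 1 by apply: cos_bnd; apply/andP; split; lra.
  have /andP[_ ?] : -1 < cos (d k) < 1 by apply: cos_bnd; apply/andP; split; lra.
  by apply/andP; split; lra.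
rewrite in_itv /= => /andP[x1 x2].
have [a xE /[dup] a0 /itv_exhaust[k /andP[h1 h2]]] : exists2 a, x = cos a & 0 < a < pi.
  exists (acos x); first by rewrite acosK // in_itv /= !ltW.
  by rewrite acos_gt0 ?acos_ltpi ?x1 ?x2 ?(ltW x1) ?(ltW x2).
have a_in : a \in `[0, pi] by move: a0; rewrite in_itv /= => /andP[? ?]; rewrite !ltW.
have [? ?] := in_angle k.
by exists k => //; rewrite /B /= in_itv /= xE !cos_le.
Qed.

Variable g : R -> R.
Hypothesis g_cont : continuous g.

Lemma measurable_weightM : measurable_fun [set: R] (EFin \o (fun s : R => w s * g s)).
Proof.
apply/measurable_EFinP; apply: measurable_funM.
  apply: (measurableT_comp (measurable_powR e)).
  by apply: measurable_funB => //; exact: measurable_funX.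
exact: continuous_measurable_fun.
Qed.

Let h (x : R) := sin x ^+ m * g (cos x).

Lemma continuous_sin_exp_comp_cos : continuous h.
Proof.
move=> x; apply: cvgM.
  by apply: (@continuous_comp _ _ _ sin (fun y => y ^+ m));
     [exact: continuous_sin|exact: exprn_continuous].
by apply: (@continuous_comp _ _ _ cos g); [exact: continuous_cos|exact: g_cont].
Qed.

Lemma integral_weight_exhaust k :
  (\int[mu]_(s in B k) (w s * g s)%:E = \int[mu]_(x in A k) (h x)%:E)%E.
Proof.
have /andP[dk0 dk1] := itv_exhaust_gt0 k; have pi0 := pi_gt0 R.
have dcos : derive1 (cos : R -> R) = (fun x => - sin x).
  by apply/funext => x; rewrite derive1E; apply: derive_val.
have csin (x : R) : - sin y @[y --> x] --> - sin x by apply: cvgN; exact: continuous_sin.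
rewrite (@integration_by_substitution_decreasing _ cos); first last.
- apply: continuous_in_subspaceT => s; rewrite inE /= in_itv /= => /andP[s1 s2].
  have /andP[? _] : -1 < cos (pi - d k) < 1 by apply: cos_bnd; apply/andP; split; lra.
  have /andP[_ ?] : -1 < cos (d k) < 1 by apply: cos_bnd; apply/andP; split; lra.
  by apply: cvgM; [apply: continuous_weight; apply/andP; split; lra|exact: g_cont].
- split=> [x _||]; first exact: ex_derive.
    by apply: cvg_at_right_filter; exact: continuous_cos.
  by apply: cvg_at_left_filter; exact: continuous_cos.
- by rewrite dcos; apply/cvg_ex; exists (- sin (pi - d k)); exact: cvg_at_left_filter.
- by rewrite dcos; apply/cvg_ex; exists (- sin (d k)); exact: cvg_at_right_filter.
- by rewrite dcos => x _; exact: csin.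
- move=> x y; rewrite !in_itv /= => /andP[? ?] /andP[? ?] xy.
  by rewrite ltr_cos // in_itv /=; apply/andP; split; lra.
- lra.
apply: eq_integral => x; rewrite inE /= in_itv /= => /andP[x1 x2].
have x0 : 0 < x < pi by apply/andP; split; lra.
congr EFin; rewrite !fctE dcos opprK /h -(weight_cos x0); ring.
Qed.

(** Monotone convergence along the two exhaustions; this is why [g] is taken nonnegative on [-1, 1].
    The endpoints are null sets, so open intervals may replace the closed ones. *)
Lemma integral_weight_ge0 : (forall s, -1 <= s <= 1 -> 0 <= g s) ->
  (\int[mu]_(s in `[(-1)%R, 1%R]) (w s * g s)%:E = \int[mu]_(x in `[0%R, pi]) (h x)%:E)%E.
Proof.
move=> g0.
have mw (D : set R) : measurable_fun D (EFin \o (fun s : R => w s * g s)).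
  exact: measurable_funS measurable_weightM.
have mh (D : set R) : measurable_fun D (EFin \o h).
  apply: (measurable_funS measurableT) => //; apply/measurable_EFinP.
  apply: continuous_measurable_fun; exact: continuous_sin_exp_comp_cos.
rewrite integral_itv_bndoo // [RHS]integral_itv_bndoo //.
rewrite -bigcup_cosines -bigcup_angles.
have c1 := @ge0_nondecreasing_set_cvg_integral _ (measurableTypeR R) R B (EFin \o (fun s : R => w s * g s)) lebesgue_measure
  nondecreasing_cosines (fun=> measurable_itv _) (fun=> mw _).
have c2 := @ge0_nondecreasing_set_cvg_integral _ (measurableTypeR R) R A (EFin \o h)
  lebesgue_measure
  nondecreasing_angles (fun=> measurable_itv _) (fun=> mh _).
have E : (fun k => \int[mu]_(s in B k) (EFin \o (fun s : R => (w s * g s)%R)) s)%E =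
    (fun k => \int[mu]_(x in A k) (EFin \o h) x)%E.
  by apply/funext => k; exact: integral_weight_exhaust.
rewrite E in c1; apply: (cvg_unique _ (c1 _) (c2 _)) => //.
  move=> k s Bs; rewrite lee_fin mulr_ge0 ?weight_ge0 // g0 //.
  have : (\bigcup_k B k) s by exists k.
  by rewrite bigcup_cosines /= in_itv /= => /andP[? ?]; rewrite !ltW.
move=> k x Ax; have : (\bigcup_k A k) x by exists k.
rewrite bigcup_angles /= in_itv /= => /[dup] /cos_bnd /andP[? ?] /andP[? ?].
by rewrite lee_fin mulr_ge0 ?exprn_ge0 ?sin_ge0_pi ?g0 //; apply/andP; split; lra.
Qed.

End GegenbauerIntegral.

Section GegenbauerPolynomial.
Variable R : realType.
Notation mu := (@lebesgue_measure R).

Lemma horner_bounded (p : {poly R}) s : -1 <= s <= 1 ->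
  `|p.[s]| <= \sum_(i < size p) `|p`_i|.
Proof.
rewrite -ler_norml => s1; rewrite horner_coef (le_trans (ler_norm_sum _ _ _)) //.
apply: ler_sum => i _; rewrite normrM ler_piMr // normrX.
by rewrite exprn_ile1.
Qed.

(** Finiteness is read off after the substitution, where the integrand is continuous on a segment
    even if the weight is unbounded. *)
Lemma integrable_weight (m : nat) (g : R -> R) : continuous g ->
  (forall s, -1 <= s <= 1 -> 0 <= g s) ->
  mu.-integrable `[-1, 1] (EFin \o (fun s : R =>
    (1 - s ^+ 2) `^ (m.+2%:R / 2 - 1 - 2^-1) * g s)).
Proof.
move=> cg g0; apply/integrableP; split.
  exact: measurable_funS (measurable_weightM _ cg).
set f := fun s : R => _; rewrite [ltLHS](_ : _ = \int[mu]_(s in `[(-1)%R, 1%R]) (f s)%:E)%E.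
  rewrite (integral_weight_ge0 m cg g0).
  apply: integrable_lty => //; apply: continuous_itv_integrable.
  exact: continuous_sin_exp_comp_cos.
apply: eq_integral => s; rewrite inE /= in_itv /= => hs.
by rewrite ger0_norm // mulr_ge0 ?powR_ge0 ?g0.
Qed.

(** A polynomial of arbitrary sign is written as [(p + M) - M], both parts being nonnegative on
    [-1, 1] when [M] bounds the values of [p] there. *)
Lemma Rintegral_weight (m : nat) (p : {poly R}) :
  \int[mu]_(s in `[-1, 1]) ((1 - s ^+ 2) `^ (m.+2%:R / 2 - 1 - 2^-1) * p.[s]) =
  \int[mu]_(x in `[0, pi]) (sin x ^+ m * p.[cos x]).
Proof.
pose M : R := \sum_(i < size p) `|p`_i|.
pose w (s : R) := (1 - s ^+ 2) `^ (m.+2%:R / 2 - 1 - 2^-1).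
have M0 : 0 <= M by apply: sumr_ge0.
have c1 : continuous (fun s : R => p.[s] + M).
  by move=> s; apply: cvgD; [exact: continuous_horner|exact: cvg_cst].
have c2 : continuous (fun _ : R => M) by move=> s; exact: cvg_cst.
have p1 (s : R) : -1 <= s <= 1 -> 0 <= p.[s] + M.
  by move=> /(horner_bounded p); rewrite -/M ler_norml => /andP[? _]; lra.
have E (g : R -> R) (cg : continuous g) (g0 : forall s : R, -1 <= s <= 1 -> 0 <= g s) :
    \int[mu]_(s in `[-1, 1]) (w s * g s) = \int[mu]_(x in `[0, pi])
      (sin x ^+ m * g (cos x)).
  by rewrite /Rintegral (integral_weight_ge0 m cg g0).
transitivity (\int[mu]_(s in `[-1, 1]) (w s * (p.[s] + M) - w s * M)).
  by apply: eq_Rintegral => s _; rewrite /w; ring.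
rewrite RintegralB //; last 2 first.
- exact: integrable_weight.
- exact: integrable_weight.
rewrite !E // -RintegralB //; last 2 first.
- by apply: continuous_itv_integrable; exact: continuous_sin_exp_comp_cos c1.
- by apply: continuous_itv_integrable; exact: continuous_sin_exp_comp_cos c2.
by apply: eq_Rintegral => x _; ring.
Qed.

(** Identifies the weighted inner product with the L2 inner product of zonal functions about the
    first axis, so that results on the sphere apply to polynomials. *)
Lemma gegenbauer_ip_zonal (m : nat) (p q : {poly R}) :
  gegenbauer_ip (m.+2%:R / 2 - 1) p q * sphere_area R m =
  sphere_integral (fun t : sphere R m.+2 => (p * q).[coords t ord0]).
Proof.
rewrite sphere_integral_zonal; last exact: continuous_horner.
rewrite mulrC -Rintegral_weight; congr (_ * _).
by apply: eq_Rintegral => s _; rewrite hornerM mulrA.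
Qed.

End GegenbauerPolynomial.

Section SphereIntegralPolyfun.
Variables (R : realType) (n : nat).
Local Notation SI := (@sphere_integral R n).
Local Notation polyfun := (is_polyfun (@coords R n)).

Lemma sphere_integral_polyfunP (a : R) f g : polyfun f -> polyfun g ->
  SI (fun t => a * f t + g t) = a * SI f + SI g.
Proof.
move=> [s /funext ->] [s' /funext ->].
have -> : (fun t => a * \sum_(p <- s) p.1 * monomial_fun (@coords R n) p.2 t +
      \sum_(p <- s') p.1 * monomial_fun (@coords R n) p.2 t) =
    fun t => \sum_(p <- [seq (a * p.1, p.2) | p <- s] ++ s')
      p.1 * monomial_fun (@coords R n) p.2 t.
  apply/funext => t; rewrite big_cat big_map mulr_sumr; congr (_ + _).
  by apply: eq_bigr => p _; rewrite /= mulrA.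
rewrite !sphere_integral_linear big_cat big_map mulr_sumr; congr (_ + _).
by apply: eq_bigr => p _; rewrite /= mulrA.
Qed.

Lemma is_polyfunZ (a : R) f : polyfun f -> polyfun (fun t => a * f t).
Proof. by move=> hf; apply: is_polyfunM => //; exact: is_polyfun_cst. Qed.

Lemma is_polyfun_sum (I : Type) (r : seq I) (f : I -> sphere R n -> R) :
  (forall i, polyfun (f i)) -> polyfun (fun t => \sum_(i <- r) f i t).
Proof.
move=> hf; elim: r => [|i r IH].
  by under eq_fun do rewrite big_nil; exact: is_polyfun_cst.
by under eq_fun do rewrite big_cons; exact: is_polyfunD.
Qed.

Lemma sphere_integral0 : SI (fun=> 0) = 0.
Proof.
have c0 : polyfun (fun=> 0) := is_polyfun_cst _ 0.
have := sphere_integral_polyfunP (-1) c0 c0; rewrite [X in _ = X + _]mulN1r addNr => h.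
by rewrite -[RHS]h; congr SI; apply/funext => t; rewrite mulr0 addr0.
Qed.

Lemma sphere_integral_sum (I : Type) (r : seq I) (a : I -> R)
    (f : I -> sphere R n -> R) : (forall i, polyfun (f i)) ->
  SI (fun t => \sum_(i <- r) a i * f i t) = \sum_(i <- r) a i * SI (f i).
Proof.
move=> hf; elim: r => [|i r IH].
  by rewrite big_nil; under eq_fun do rewrite big_nil; exact: sphere_integral0.
rewrite big_cons -IH -sphere_integral_polyfunP //; last first.
  by apply: is_polyfun_sum => j; exact: is_polyfunZ.
by congr SI; apply/funext => t; rewrite big_cons.
Qed.

End SphereIntegralPolyfun.

(** * Spherical harmonics in dimension m + 2 *)

Section SphericalHarmonics.
Variables (R : realType) (m : nat).
Local Notation n := m.+2.
Local Notation S := (sphere R n).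
Local Notation SI := (@sphere_integral R n).
Local Notation polyfun := (is_polyfun (@coords R n)).
Local Notation Harm := (@spherical_harmonics R n).
Local Notation G := (ZonalHarmonics.gegen R n).
Implicit Types s t : S.

Lemma sphere_first_subproof : (delta_mx ord0 0 : 'cV[R]_n) \in @sphere_set R n.
Proof.
rewrite inE /sphere_set /= /dot mxE (bigD1 ord0) //= big1 ?addr0 => [|i i0].
  by rewrite !mxE eqxx mulr1 sqrtr1.
by rewrite !mxE (negPf i0) mulr0.
Qed.

(** Hyperspherical coordinates are built around the first axis, so a zonal function with this pole
    depends on the first coordinate alone. *)
Definition sphere_first : S := exist _ (delta_mx ord0 0 : 'cV[R]_n) sphere_first_subproof.

Lemma dot_coords s t : dot (\val s) (\val t) = \sum_i coords s i * coords t i.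
Proof. by rewrite /dot mxE; apply: eq_bigr => i _; rewrite mxE. Qed.

Lemma sum_coords_sqr t : \sum_i coords t i ^+ 2 = 1.
Proof. by rewrite -(dot_sphere t) dot_coords; apply: eq_bigr => i _; rewrite expr2. Qed.

Lemma harmonic_polyfun l f : Harm l f -> polyfun f.
Proof. exact: ZonalHarmonics.harmonic_restriction_poly. Qed.

Lemma harmonic_orthogonal l k f g : Harm l f -> Harm k g -> l != k ->
  L2_ip f g = 0.
Proof.
by apply: ZonalHarmonics.harmonic_restriction_orthogonal; rewrite //;
  [exact: sphere_integral_linear|exact: sphere_moments].
Qed.

Lemma zonal_harmonic l s : Harm l (fun t => (G l).[dot (\val s) (\val t)]).
Proof.
have -> : (fun t => (G l).[dot (\val s) (\val t)]) =
    (fun t => (G l).[\sum_i coords s i * coords t i]).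
  by apply/funext => t; rewrite dot_coords.
by apply: ZonalHarmonics.zonal_restriction => //; exact: sum_coords_sqr.
Qed.

Lemma funk_hecke_gegen l : exists kappa : R, forall s Y, Harm l Y ->
  L2_ip (fun t => (G l).[dot (\val s) (\val t)]) Y = kappa * Y s.
Proof.
have [] := @ZonalHarmonics.funk_hecke_restriction R n isT S (@coords R n) SI
  (@sphere_integral_linear R n) (@sphere_moments R m.+1) l (G l).
  by rewrite ZonalHarmonics.size_gegen.
move=> k hk; exists k => s Y hY; rewrite -hk //; congr SI.
by apply/funext => t; rewrite dot_coords.
Qed.

Section Basis.
Variables (l d : nat) (Y : 'I_d -> S -> R).
Hypothesis hY : is_L2_orthonormal_basis (Harm l) Y.

Lemma basis_polyfun k : polyfun (Y k).
Proof. by case: hY => -[hb _ _] _; exact: harmonic_polyfun (hb k). Qed.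

Lemma L2_ip_basis (a : 'I_d -> R) k :
  L2_ip (fun t => \sum_j a j * Y j t) (Y k) = a k.
Proof.
transitivity (SI (fun t => \sum_j a j * (Y j t * Y k t))).
  by congr SI; apply/funext => t; rewrite mulr_suml; apply: eq_bigr => j _; rewrite mulrA.
rewrite sphere_integral_sum; last by move=> j; apply: is_polyfunM; exact: basis_polyfun.
rewrite (bigD1 k) //= [SI _](hY.2 k k) eqxx mulr1 big1 ?addr0 // => j jk.
by rewrite [SI _](hY.2 j k) (negPf jk) mulr0.
Qed.

Lemma L2_ip_basis_sqr (a : 'I_d -> R) :
  L2_ip (fun t => \sum_j a j * Y j t) (fun t => \sum_j a j * Y j t) = \sum_j a j ^+ 2.
Proof.
pose f t := \sum_j a j * Y j t.
transitivity (SI (fun t => \sum_j a j * (f t * Y j t))).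
  congr SI; apply/funext => t; rewrite -/(f t) {2}/f mulr_sumr.
  by apply: eq_bigr => j _; rewrite mulrCA.
have pf : polyfun f by apply: is_polyfun_sum => j; exact/is_polyfunZ/basis_polyfun.
rewrite sphere_integral_sum; last by move=> j; apply: is_polyfunM => //;
  exact: basis_polyfun.
by apply: eq_bigr => j _; rewrite [SI _]L2_ip_basis expr2.
Qed.

Lemma basis_expansion f : Harm l f -> f = fun t => \sum_j L2_ip f (Y j) * Y j t.
Proof.
case: hY => -[_ _ hs] _ /hs[a ->]; have E : \sum_k a k *: Y k = fun t => \sum_j a j * Y j t.
  by apply/funext => t; rewrite fct_sumE.
by rewrite E; apply/funext => t; apply: eq_bigr => j _; rewrite L2_ip_basis.
Qed.

(** By the Funk-Hecke formula the coefficient of the zonal function on [Y j] is [mu * Y j s]. At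
    [t = s] the sum gives mu sum_k Y_k(s)^2 = 1, which forces [mu] to be positive. Parseval then
    gives the squared norm mu^2 sum_k Y_k(s)^2 = mu. *)
Lemma gegen_addition : exists mu : R, [/\ 0 < mu,
  forall s t, (G l).[dot (\val s) (\val t)] = mu * \sum_k Y k s * Y k t &
  forall s, SI (fun t => (G l).[dot (\val s) (\val t)] ^+ 2) = mu].
Proof.
have [mu hmu] := funk_hecke_gegen l; exists mu.
have E s : (fun t => (G l).[dot (\val s) (\val t)]) =
    fun t => \sum_j (mu * Y j s) * Y j t.
  rewrite {1}(basis_expansion (zonal_harmonic l s)); apply/funext => t.
  by apply: eq_bigr => j _; rewrite hmu //; case: hY => -[].
have Es s t : (G l).[dot (\val s) (\val t)] = mu * \sum_k Y k s * Y k t.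
  have := congr1 (fun f => f t) (E s) => /= ->.
  by rewrite mulr_sumr; apply: eq_bigr => j _; rewrite mulrA.
have E1 s : mu * \sum_k Y k s ^+ 2 = 1.
  have := Es s s; rewrite dot_sphere ZonalHarmonics.gegen1 //.

split; [|exact: Es|move=> s].
  have := E1 sphere_first; have : 0 <= \sum_k Y k sphere_first ^+ 2.
    by apply: sumr_ge0 => k _; exact: sqr_ge0.
  by nra.
have -> : (fun t => (G l).[dot (\val s) (\val t)] ^+ 2) = 
   (fun t => (G l).[dot (\val s) (\val t)] * (G l).[dot (\val s) (\val t)]).
  by apply/funext => t; rewrite expr2.
rewrite -/(L2_ip (fun t => (G l).[dot (\val s) (\val t)]) (fun t => (G l).[dot (\val s)
  (\val t)])) E L2_ip_basis_sqr.
rewrite -[RHS]mulr1 -(E1 s) !mulr_sumr; apply: eq_bigr => k _.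
by rewrite exprMn expr2 mulrA.
Qed.

End Basis.
End SphericalHarmonics.

Lemma quadratic_discriminant (R : realFieldType) (a b c : R) : 0 <= c ->
  (forall x, 0 <= a + x * b * 2 + x ^+ 2 * c) -> b ^+ 2 <= a * c.
Proof.
rewrite le_eqVlt => /predU1P[<- h|c0 h].
  rewrite mulr0; have [->|b0] := eqVneq b 0; first by rewrite expr0n.
  (* With [c = 0] and [b != 0] the quadratic is affine, and this point is where it takes the value
     -1. *)
  have := h (- (a + 1) / (b * 2)).
  have -> : a + - (a + 1) / (b * 2) * b * 2 + (- (a + 1) / (b * 2)) ^+ 2 * 0 = -1.
    by field.
  by rewrite ler0N1.
have := h (- b / c); have -> : a + - b / c * b * 2 + (- b / c) ^+ 2 * c =
  (a * c - b ^+ 2) / c.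
  by field; rewrite gt_eqF.
by rewrite pmulr_lge0 ?invr_gt0 // subr_ge0.
Qed.

(** * The given Gegenbauer polynomials and the addition theorem *)

Section AdditionTheorem.
Variables (R : realType) (m : nat).
Local Notation n := m.+2.
Local Notation S := (sphere R n).
Local Notation SI := (@sphere_integral R n).
Local Notation Harm := (@spherical_harmonics R n).
Local Notation G := (ZonalHarmonics.gegen R n).
Local Notation lambda := (n%:R / 2 - 1).

Lemma dot_sphere_first (t : S) : dot (\val (sphere_first R m)) (\val t) = coords t ord0.
Proof.
rewrite /dot mxE (bigD1 ord0) //= big1 ?addr0 => [|i i0].
  by rewrite !mxE eqxx mul1r.
by rewrite !mxE (negPf i0) mul0r.
Qed.

Lemma coords_polyfun i : is_polyfun (@coords R n) (fun t => coords t i).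
Proof.
exists [:: (1, fun j => nat_of_bool (j == i))] => t.
rewrite big_seq1 mul1r /monomial_fun (bigD1 i) //= eqxx expr1 big1 ?mulr1 // => j ji.
by rewrite (negPf ji) expr0.
Qed.

Lemma horner_polyfun (p : {poly R}) f : is_polyfun (@coords R n) f ->
  is_polyfun (@coords R n) (fun t => p.[f t]).
Proof.
move=> pf; elim/poly_ind: p => [|p c IH].
  by under eq_fun do rewrite horner0; exact: is_polyfun_cst.
under eq_fun do rewrite hornerMXaddC.
by apply: is_polyfunD; [exact: is_polyfunM|exact: is_polyfun_cst].
Qed.

Local Notation B p q := (gegenbauer_ip lambda p q * sphere_area R m).

Lemma gegenbauer_ip_linear (a : R) (p q r : {poly R}) :
  B (a *: p + q) r = a * B p r + B q r.
Proof.
rewrite !gegenbauer_ip_zonal -sphere_integral_polyfunP.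
- by congr SI; apply/funext => t; rewrite mulrDl -scalerAl hornerD hornerZ.
- exact/horner_polyfun/coords_polyfun.
- exact/horner_polyfun/coords_polyfun.
Qed.

Lemma graded_basis_expansion (P : nat -> {poly R}) (l : nat) (p : {poly R}) :
  (forall j, size (P j) = j.+1) -> (size p <= l)%N ->
  exists a : nat -> R, p = \sum_(j < l) a j *: P j.
Proof.
move=> sP; elim: l p => [|l IH] p.
  by rewrite leqn0 size_poly_eq0 => /eqP ->; exists (fun=> 0); rewrite big_ord0.
move=> sp; pose c := p`_l / lead_coef (P l).
have lP : lead_coef (P l) != 0 by rewrite lead_coef_eq0 -size_poly_eq0 sP.
have [|a pa] := IH (p - c *: P l).
  apply/leq_sizeP => j; rewrite leq_eqVlt => /orP[/eqP <-|lj].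
    rewrite coefB coefZ; have -> : (P l)`_l = lead_coef (P l) by rewrite lead_coefE sP.
    by rewrite divfK // subrr.
  rewrite coefB coefZ !nth_default ?mulr0 ?subr0 //; first by rewrite sP.
  exact: leq_trans sp lj.
exists (fun j => if j == l then c else a j); rewrite big_ord_recr /= eqxx.
rewrite -[p](subrK (c *: P l)) pa; congr (_ + _); apply: eq_bigr => j _.
by rewrite ltn_eqF.
Qed.

Variable C : nat -> {poly R}.
Hypothesis hC : is_gegenbauer lambda C.
Variable Y : forall l : nat, 'I_(Nharm R n l) -> S -> R.
Hypothesis hY : forall l, is_L2_orthonormal_basis (Harm l) (@Y l).

Lemma gegenbauer_ip_gegen_neq l k : l != k -> B (G l) (G k) = 0.
Proof.
move=> lk; rewrite gegenbauer_ip_zonal.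
rewrite -(harmonic_orthogonal (zonal_harmonic l (sphere_first R m))
  (zonal_harmonic k (sphere_first R m)) lk).
by congr SI; apply/funext => t; rewrite !dot_sphere_first hornerM.
Qed.

Lemma gegenbauer_ip_gegen l : exists2 mu : R, 0 < mu & B (G l) (G l) = mu /\
  forall s t : S, (G l).[dot (\val s) (\val t)] = mu * \sum_k @Y l k s * @Y l k t.
Proof.
have [mu [mu0 add nrm]] := gegen_addition (hY l); exists mu => //; split=> //.
rewrite gegenbauer_ip_zonal -(nrm (sphere_first R m)); congr SI; apply/funext => t.
by rewrite dot_sphere_first hornerM expr2.
Qed.

(** Both sequences are orthogonal and graded by degree. In the expansion of [C l] along the [G j],
    pairing with [G k], which is [C k] by induction, kills the coefficients below [l]; the squared
    norm of [G k] is nonzero, being the constant of the addition formula. The value at 1 fixes the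
    last coefficient. *)
Lemma gegenbauer_gegen l : C l = G l.
Proof.
case: hC => sC oC C1; elim/ltn_ind: l => l IH.
have [|a Ca] := @graded_basis_expansion G l.+1 (C l) (@ZonalHarmonics.size_gegen R n isT).
  by rewrite sC.
have BG k (p : nat -> R) (q : {poly R}) :
    B (\sum_(j < k) p j *: G j) q = \sum_(j < k) p j * B (G j) q.
  elim: k => [|k IHk].
    rewrite !big_ord0 /gegenbauer_ip.
    under eq_Rintegral do rewrite horner0 mulr0 mul0r.
    by rewrite Rintegral_cst // !mul0r.
  by rewrite !big_ord_recr /= addrC gegenbauer_ip_linear IHk addrC.
have a0 (k : 'I_l) : a k = 0.
  have := BG l.+1 a (G k); rewrite -Ca -(IH k (ltn_ord k)) oC; last first.
    by rewrite gtn_eqF.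
  rewrite (IH k (ltn_ord k)) mul0r (bigD1 (widen_ord (leqnSn l) k)) //= big1.
    have [mu mu0 [-> _]] := gegenbauer_ip_gegen k.
    by rewrite addr0 => /esym/eqP; rewrite mulf_eq0 (gt_eqF mu0) orbF => /eqP.
  by move=> j jk; rewrite gegenbauer_ip_gegen_neq ?mulr0 // -val_eqE.
have := C1 l; rewrite Ca big_ord_recr /= big1 ?add0r => [|k _]; last by rewrite a0 scale0r.
by rewrite hornerZ ZonalHarmonics.gegen1 // mulr1 => ->; rewrite scale1r.
Qed.

Lemma addition_theorem l :
  0 < gegenbauer_p lambda C l * sphere_area R m /\
  forall s t : S, (C l).[dot (\val s) (\val t)] =
    gegenbauer_p lambda C l * sphere_area R m * \sum_k @Y l k s * @Y l k t.
Proof.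
rewrite /gegenbauer_p gegenbauer_gegen.
by have [mu mu0 [-> hmu]] := gegenbauer_ip_gegen l.
Qed.

End AdditionTheorem.

(** * Coefficients of uniformly convergent harmonic series *)

Section Coefficients.
Variables (R : realType) (m : nat).
Local Notation n := m.+2.
Local Notation S := (sphere R n).
Local Notation SI := (@sphere_integral R n).
Local Notation Harm := (@spherical_harmonics R n).
Variable Y : forall l : nat, 'I_(Nharm R n l) -> S -> R.
Hypothesis hY : forall l, is_L2_orthonormal_basis (Harm l) (@Y l).

Lemma sphere_integral_cauchy_schwarz f g :
  is_polyfun (@coords R n) f -> is_polyfun (@coords R n) g ->
  SI (fun t => f t * g t) ^+ 2 <= SI (fun t => f t ^+ 2) * SI (fun t => g t ^+ 2).
Proof.
move=> pf pg; have pq h : is_polyfun (@coords R n) h -> is_polyfun (@coords R n)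
  (fun t => h t ^+ 2).
  by move=> ph; under eq_fun do rewrite expr2; exact: is_polyfunM.
have pfg := is_polyfunM pf pg.
apply: quadratic_discriminant => [|x].
  by apply: sphere_integral_ge0 => t; exact: sqr_ge0.
have -> : SI (fun t => f t ^+ 2) + x * SI (fun t => f t * g t) * 2 +
    x ^+ 2 * SI (fun t => g t ^+ 2) = SI (fun t => (f t + x * g t) ^+ 2).
  transitivity (SI (fun t => x ^+ 2 * g t ^+ 2 + (2 * x * (f t * g t) + f t ^+ 2))).
    by rewrite !sphere_integral_polyfunP //; [ring|exact: pq|exact: pq|
       apply: is_polyfunD; [exact: is_polyfunZ|exact: pq]].
  by congr SI; apply/funext => t; ring.
by apply: sphere_integral_ge0 => t; exact: sqr_ge0.
Qed.

(** The remainder [P L] is a polynomial function bounded on the whole sphere by the tail [e L] of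
    the majorant. Orthogonality turns its integral against [Y l0 k0] into the difference of the two
    sides, and Cauchy-Schwarz bounds the square of that integral by [e L] squared times the area. It
    serves with [v = 0] for uniqueness and with [v] the value of the kernel at the centre. *)
Lemma harmonic_coefficients (d : forall l, 'I_(Nharm R n l) -> R) (b : nat -> R) (v : R) :
  cvgn (series b) ->
  (forall l t, `|\sum_k d l k * @Y l k t| <= b l) ->
  (forall t, series (fun l => \sum_k d l k * @Y l k t) @ \oo --> v) ->
  forall l k, d l k = v * SI (@Y l k).
Proof.
move=> cb fb fv l0 k0.
pose f l (t : S) := \sum_k d l k * @Y l k t.
pose e L := limn (series b) - series b L.
pose P L t := series (fun l => f l t) L - v.
have polyf l : is_polyfun (@coords R n) (f l).
  by apply: is_polyfun_sum => k; exact/is_polyfunZ/(basis_polyfun (hY l)).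
have polys L : is_polyfun (@coords R n) (fun t => series (fun l => f l t) L).
  exact: is_polyfun_sum.
have polyP L : is_polyfun (@coords R n) (P L).
  by apply: is_polyfunD => //; exact: is_polyfun_cst.
have Pe L t : `|P L t| <= e L.
  have c1 : (fun L' => `|series (fun l => f l t) L - series (fun l => f l t) L'|) @ \oo --> `|P L t|.
    by apply: cvg_norm; apply: cvgB; [exact: cvg_cst|exact: fv].
  have c2 : (fun L' => series b L' - series b L) @ \oo --> e L.
    by apply: cvgB; [exact: cb|exact: cvg_cst].
  apply: (ler_cvg_to c1 c2); exists L => // L' /= LL'.
  rewrite distrC !sub_series_geq // (le_trans (ler_norm_sum _ _ _)) //.
  by apply: ler_sum => l _; exact: fb.
have e0 L : 0 <= e L by exact: le_trans (normr_ge0 _) (Pe L (sphere_first R m)).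
have ce : e @ \oo --> 0.
  by rewrite -(subrr (limn (series b))); apply: cvgB; [exact: cvg_cst|exact: cb].
pose x := (d l0 k0 - v * SI (@Y l0 k0)) ^+ 2.
(* [L] has to exceed [l0] for the partial sum to contain the degree [l0]. *)
have xe L : (l0 < L)%N -> x <= e L * e L * sphere_area R m.+1.
  move=> lL; have pY := basis_polyfun (hY l0) k0.
  have -> : x = SI (fun t => P L t * @Y l0 k0 t) ^+ 2.
    congr (_ ^+ 2).
    transitivity (SI (fun t => - v * @Y l0 k0 t + \sum_(0 <=
      l < L) 1 * (f l t * @Y l0 k0 t))).
      rewrite sphere_integral_polyfunP //; last first.
        by apply: is_polyfun_sum => l; apply: is_polyfunZ; exact: is_polyfunM.
      rewrite sphere_integral_sum; last by move=> l; exact: is_polyfunM.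
      rewrite (bigD1_seq l0) ?iota_uniq ?mem_index_iota //= big1 ?addr0.
        have -> : SI (fun t => f l0 t * @Y l0 k0 t) = d l0 k0.
          exact: (L2_ip_basis (hY l0) (d l0) k0).
        by ring.
      move=> l ll0; rewrite mul1r.
      have -> : (fun t => f l t * @Y l0 k0 t) =
        (fun t => \sum_k d l k * (@Y l k t * @Y l0 k0 t)).
        apply/funext => t; rewrite mulr_suml; apply: eq_bigr => k _; by rewrite mulrA.
      rewrite sphere_integral_sum; last first.
        by move=> k; apply: is_polyfunM => //; exact: basis_polyfun (hY l) k.
      apply: big1 => k _; rewrite [SI _](@harmonic_orthogonal _ _ l l0) ?mulr0 //.
        by case: (hY l) => -[].
      by case: (hY l0) => -[].
    congr SI; apply/funext => t; rewrite /P mulrBl addrC mulNr; congr (_ - _).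
    by rewrite mulr_suml; apply: eq_bigr => l _; rewrite mul1r.
  apply: le_trans (sphere_integral_cauchy_schwarz (polyP L) pY) _.
  have -> : SI (fun t => @Y l0 k0 t ^+ 2) = 1.
    rewrite -[RHS]/(true%:R) -(eqxx k0) -((hY l0).2 k0 k0).
    by congr SI; apply/funext => t; rewrite expr2.
  (* Monotonicity of the integral is obtained from its linearity on polynomial functions and its
     positivity. *)
  rewrite mulr1 -sphere_integral_cst -subr_ge0.
  have -> : SI (fun=> e L * e L) - SI (fun t => P L t ^+ 2) =
      SI (fun t => -1 * (P L t * P L t) + e L * e L).
    rewrite sphere_integral_polyfunP; last 2 first.
    - exact: is_polyfunM.
    - exact: is_polyfun_cst.
    by rewrite mulN1r addrC; congr (- _ + _); congr SI; apply/funext => t; rewrite expr2.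
  apply: sphere_integral_ge0 => t; rewrite mulN1r addrC subr_ge0.
  rewrite -[P L t * _]ger0_norm; last by rewrite -expr2 sqr_ge0.
  by rewrite normrM ler_pM.
suff : x <= 0.
  by move=> x0; apply/eqP; rewrite -subr_eq0 -sqrf_eq0 eq_le [_ <= 0]x0 sqr_ge0.
have -> : 0 = 0 * 0 * sphere_area R m.+1 :> R by rewrite !mul0r.
have c : (fun L => e L * e L * sphere_area R m.+1) @ \oo --> 0 * 0 * sphere_area R m.+1.
  by apply: cvgM; [apply: cvgM; exact: ce|exact: cvg_cst].
apply: (cvgr_to_ge c); by exists l0.+1 => // L /= lL; exact: xe.
Qed.
End Coefficients.

(** * Reproducing kernel Hilbert spaces *)

Lemma cvg0_of_sqr_le (R : realType) (x y : nat -> R) :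
  (forall k, x k ^+ 2 <= y k) -> y @ \oo --> 0 -> x @ \oo --> 0.
Proof.
move=> xy y0; have c : (fun k => Num.sqrt (y k)) @ \oo --> 0.
  by rewrite -sqrtr0; apply: continuous_cvg => //; exact: sqrt_continuous.
apply/cvgr0Pnorm_le => e e0; move/cvgr0_norm_le: c => /(_ e e0).
apply: filterS => k; rewrite ger0_norm ?sqrtr_ge0 //; apply: le_trans.
by rewrite -sqrtr_sqr ler_sqrt // (le_trans _ (xy k)) ?sqr_ge0.
Qed.

Section Hilbert.
Variables (R : realType) (T : Type) (H : ip_space R T).
Hypothesis hH : is_hilbert H.
Implicit Types (f g : T -> R) (u : nat -> T -> R).
Local Notation mem := (carrier H).

Lemma hilbertZ a f : mem f -> mem (a *: f).
Proof. by move=> hf; rewrite -[a *: f]addr0; apply: hilbertD => //; exact: hilbert0. Qed.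

Lemma hilbert_add f g : mem f -> mem g -> mem (f + g).
Proof. by move=> hf hg; rewrite -[f]scale1r; exact: hilbertD. Qed.

Lemma hilbert_sub f g : mem f -> mem g -> mem (f - g).
Proof. by move=> hf hg; rewrite addrC -scaleN1r; exact: hilbertD. Qed.

Lemma hilbert_sum (I : Type) (r : seq I) (F : I -> T -> R) :
  (forall i, mem (F i)) -> mem (\sum_(i <- r) F i).
Proof.
move=> hF; elim: r => [|i r IH]; first by rewrite big_nil; exact: hilbert0.
by rewrite big_cons; exact: hilbert_add.
Qed.

Lemma ipDZr a f g k : mem f -> mem g -> mem k ->
  ip H k (a *: f + g) = a * ip H k f + ip H k g.
Proof.
move=> hf hg hk; rewrite ipC // ?ipDl // 1?(ipC hH hk hf) 1?(ipC hH hk hg) //.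
exact: hilbertD.
Qed.

Lemma ip0r k : mem k -> ip H k 0 = 0.
Proof.
move=> hk; have h0 := hilbert0 hH; have := ipDZr (-1) h0 h0 hk.
by rewrite scaler0 addr0 mulN1r addNr.
Qed.

Lemma ip_sumr (I : Type) (r : seq I) (a : I -> R) (F : I -> T -> R) k :
  (forall i, mem (F i)) -> mem k ->
  ip H k (\sum_(i <- r) a i *: F i) = \sum_(i <- r) a i * ip H k (F i).
Proof.
move=> hF hk; elim: r => [|i r IH]; first by rewrite !big_nil ip0r.
by rewrite !big_cons ipDZr ?IH //; apply: hilbert_sum => j; exact: hilbertZ.
Qed.

Lemma sqnorm_ge0 f : mem f -> 0 <= sqnorm H f.
Proof. exact: ip_ge0. Qed.

Lemma sqnormDZ a f g : mem f -> mem g ->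
  sqnorm H (a *: f + g) = a ^+ 2 * sqnorm H f + 2 * a * ip H f g + sqnorm H g.
Proof.
move=> hf hg; rewrite /sqnorm ipDl //; last exact: hilbertD.
by rewrite !ipDZr // (ipC hH hg hf); ring.
Qed.

Lemma sqnormD f g : mem f -> mem g ->
  sqnorm H (f + g) = sqnorm H f + 2 * ip H f g + sqnorm H g.
Proof. by move=> hf hg; rewrite -{1}[f]scale1r sqnormDZ // expr1n mul1r mulr1. Qed.

Lemma sqnormB f g : mem f -> mem g ->
  sqnorm H (f - g) = sqnorm H f - 2 * ip H f g + sqnorm H g.
Proof.
move=> hf hg; rewrite addrC -scaleN1r sqnormDZ // (ipC hH hg hf); ring.
Qed.

Lemma sqnormZ a f : mem f -> sqnorm H (a *: f) = a ^+ 2 * sqnorm H f.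
Proof.
move=> hf; have h0 := hilbert0 hH; rewrite -[a *: f]addr0 sqnormDZ // ip0r //.
by rewrite [sqnorm H 0]ip0r // mulr0 !addr0.
Qed.

Lemma sqnormBC f g : mem f -> mem g -> sqnorm H (f - g) = sqnorm H (g - f).
Proof. by move=> hf hg; rewrite !sqnormB // (ipC hH hg hf); ring. Qed.

Lemma ip_cauchy_schwarz f g : mem f -> mem g ->
  ip H f g ^+ 2 <= sqnorm H f * sqnorm H g.
Proof.
move=> hf hg; apply: quadratic_discriminant => [|x]; first exact: sqnorm_ge0.
have : 0 <= sqnorm H (x *: g + f) by apply: sqnorm_ge0; exact: hilbertD.
by rewrite sqnormDZ // (ipC hH hg hf); lra.
Qed.

Lemma sqnorm_parallelogram_le f g : mem f -> mem g ->
  sqnorm H (f + g) <= 2 * sqnorm H f + 2 * sqnorm H g.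
Proof.
move=> hf hg; have := sqnorm_ge0 (hilbert_sub hf hg).
by rewrite sqnormB // sqnormD //; lra.
Qed.

Lemma hilbert_complete_sqr u : (forall k, mem (u k)) ->
  (forall e : R, 0 < e -> exists N : nat, forall p q : nat,
       (N <= p)%N -> (N <= q)%N -> sqnorm H (u p - u q) < e) ->
  exists2 f, mem f & (fun k => sqnorm H (u k - f)) @ \oo --> (0 : R).
Proof.
move=> hu cu; have [|f hf cf] := hilbert_complete hH hu.
  move=> e e0; have [N hN] := cu (e ^+ 2) (exprn_gt0 2 e0); exists N => p q Np Nq.
  by rewrite -[ltRHS]ger0_norm ?ltW // -sqrtr_sqr ltr_sqrt ?exprn_gt0 // hN.
exists f => //; have -> : (fun k => sqnorm H (u k - f)) =
    fun k => Num.sqrt (sqnorm H (u k - f)) * Num.sqrt (sqnorm H (u k - f)).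
  apply/funext => k; rewrite -expr2 sqr_sqrtr // sqnorm_ge0 //; exact: hilbert_sub.
by rewrite -(mulr0 0); exact: cvgM.
Qed.

Lemma ip_cvg u f g : (forall k, mem (u k)) -> mem f -> mem g ->
  (fun k => sqnorm H (u k - f)) @ \oo --> (0 : R) ->
  (fun k => ip H (u k) g) @ \oo --> ip H f g.
Proof.
move=> hu hf hg c; apply/subr_cvg0; apply: (@cvg0_of_sqr_le _ _
    (fun k => sqnorm H (u k - f) * sqnorm H g)).
  move=> k; have -> : ip H (u k) g - ip H f g = ip H (u k - f) g.
    by rewrite [u k - f]addrC -(scaleN1r f) ipDl // mulN1r addrC.
  apply: ip_cauchy_schwarz => //; exact: hilbert_sub.
by rewrite -(mul0r (sqnorm H g)); apply: cvgM => //; exact: cvg_cst.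
Qed.

Lemma sqnorm_cvg u f : (forall k, mem (u k)) -> mem f ->
  (fun k => sqnorm H (u k - f)) @ \oo --> (0 : R) ->
  (fun k => sqnorm H (u k)) @ \oo --> sqnorm H f.
Proof.
move=> hu hf c; have -> : (fun k => sqnorm H (u k)) =
    fun k => sqnorm H (u k - f) + 2 * ip H (u k) f - sqnorm H f.
  by apply/funext => k; rewrite sqnormB //; ring.
rewrite [X in _ --> X](_ : _ = 0 + 2 * ip H f f - sqnorm H f); last by rewrite /sqnorm;
  ring.
apply: cvgB; last exact: cvg_cst.
by apply: cvgD; [exact: c|apply: cvgM; [exact: cvg_cst|exact: ip_cvg]].
Qed.

Lemma hilbert_cvg_unique u f g : (forall k, mem (u k)) -> mem f -> mem g ->
  (fun k => sqnorm H (u k - f)) @ \oo --> (0 : R) ->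
  (fun k => sqnorm H (u k - g)) @ \oo --> (0 : R) -> f = g.
Proof.
move=> hu hf hg cf cg; have fg : mem (f - g) by exact: hilbert_sub.
suff : sqnorm H (f - g) = 0 by move=> /(ip_eq0 hH fg) /eqP; rewrite subr_eq0 => /eqP.
apply/eqP; rewrite eq_le sqnorm_ge0 // andbT.
have c : (fun k => 2 * sqnorm H (u k - f) + 2 * sqnorm H (u k - g)) @ \oo -->
  (2 * 0 + 2 * 0 : R).
  by apply: cvgD; apply: cvgM => //; exact: cvg_cst.
rewrite [leRHS](_ : _ = 2 * 0 + 2 * 0); last by rewrite mulr0 addr0.
apply: (cvgr_to_ge c); apply: nearW => k.
rewrite (sqnormBC (hu k) hf) (_ : f - g = (f - u k) + (u k - g)).
  by apply: sqnorm_parallelogram_le; exact: hilbert_sub.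
by rewrite addrA subrK.
Qed.

End Hilbert.

(** * Combinations of sections and Riesz's theorem *)

Section RKHS.
Variables (R : realType) (T : Type) (K : T -> T -> R) (H : ip_space R T).
Hypothesis hH : is_rkhs K H.
Implicit Types (f g : T -> R) (s : seq (R * T)).
Local Notation mem := (carrier H).
Let hilb := rkhs_hilbert hH.

Definition kernel_comb s : T -> R := \sum_(p <- s) p.1 *: K p.2.

Definition weighted_eval s f : R := \sum_(p <- s) p.1 * f p.2.

Lemma kernel_comb_mem s : mem (kernel_comb s).
Proof.
by apply: hilbert_sum => // p; apply: hilbertZ => //; exact: (rkhs_section hH).
Qed.
Hint Resolve kernel_comb_mem : core.

Lemma kernel_combD a s s' :
  kernel_comb ([seq (a * p.1, p.2) | p <- s] ++ s') = a *: kernel_comb s + kernel_comb s'.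
Proof.
rewrite /kernel_comb big_cat big_map scaler_sumr; congr (_ + _).
by apply: eq_bigr => p _; rewrite scalerA.
Qed.

Lemma weighted_evalD a s s' f :
  weighted_eval ([seq (a * p.1, p.2) | p <- s] ++ s') f =
  a * weighted_eval s f + weighted_eval s' f.
Proof.
rewrite /weighted_eval big_cat big_map mulr_sumr; congr (_ + _).
by apply: eq_bigr => p _; rewrite mulrA.
Qed.

Lemma ip_kernel_comb s f : mem f -> ip H f (kernel_comb s) = weighted_eval s f.
Proof.
move=> hf; rewrite ip_sumr //; last by move=> p; exact: (rkhs_section hH).
by apply: eq_bigr => p _; rewrite -(rkhs_reproducing hH).
Qed.

Lemma sqnorm_section x : sqnorm H (K x) = K x x.
Proof. by rewrite /sqnorm -(rkhs_reproducing hH) //; exact: (rkhs_section hH). Qed.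

Lemma rkhs_eval_le f x : mem f -> f x ^+ 2 <= sqnorm H f * K x x.
Proof.
move=> hf; rewrite (rkhs_reproducing hH x hf) -sqnorm_section.
by apply: ip_cauchy_schwarz => //; exact: (rkhs_section hH).
Qed.

Lemma rkhs_bounded f s : mem f ->
  weighted_eval s f ^+ 2 <= sqnorm H f * sqnorm H (kernel_comb s).
Proof. by move=> hf; rewrite -ip_kernel_comb //; exact: ip_cauchy_schwarz. Qed.

Section Riesz.
Variables (f : T -> R) (M : R).
Hypothesis fM : forall s, weighted_eval s f ^+ 2 <= M * sqnorm H (kernel_comb s).
Hypothesis M0 : 0 <= M.

(** For [f] in the space this would be |kernel_comb s - f|^2 - |f|^2, so minimizing it approximates
    [f]; the expression makes sense before membership of [f] is known. *)
Let Q s := sqnorm H (kernel_comb s) - 2 * weighted_eval s f.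

(** The arithmetic-geometric inequality: 2 E <= 2 sqrt(M N) <= M + N, with [N] the squared norm and
    [E] the evaluation. *)
Lemma riesz_energy_ge s : - M <= Q s.
Proof.
rewrite /Q; have := fM s; have := sqnorm_ge0 hilb (kernel_comb_mem s).
move: (sqnorm _ _) (weighted_eval _ _) => N E N0 h.
rewrite leNgt; apply/negP => lt.
have MN : 0 <= M + N by exact: addr_ge0.
have : (M + N) ^+ 2 < (2 * E) ^+ 2 by rewrite ltr_sqr ?nnegrE; lra.
by have := sqr_ge0 (M - N); nra.
Qed.

Let d := inf (range Q).

Let has_infQ : has_inf (range Q).
Proof.
split; first by exists (Q [::]); exists [::].
by exists (- M) => _ [s _ <-]; exact: riesz_energy_ge.
Qed.

Let d_le s : d <= Q s.
Proof. by apply: ge_inf; [exact: has_infQ.2|exists s]. Qed.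

(* By the parallelogram law applied to the midpoint of the combinations. *)
Lemma riesz_minimizing_close s s' (e : R) : Q s <= d + e -> Q s' <= d + e ->
  sqnorm H (kernel_comb s - kernel_comb s') <= 4 * e.
Proof.
move=> h h'; have := d_le ([seq (2^-1 * p.1, p.2) | p <- s] ++
  ([seq (2^-1 * p.1, p.2) | p <- s'] ++ [::])).
move: h h'; rewrite /Q !(kernel_combD, weighted_evalD) /kernel_comb /weighted_eval !big_nil.
rewrite !addr0 -/(kernel_comb s) -/(kernel_comb s') -/(weighted_eval _ _) -/(weighted_eval _ _).
rewrite sqnormDZ ?sqnormZ ?sqnormB //; last exact: hilbertZ.
rewrite -[_ *: kernel_comb s']addr0 ipDZr // ?ip0r //; last exact: hilbert0.
move: (sqnorm H (kernel_comb s)) (sqnorm H (kernel_comb s')) (ip H _ _).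
by move: (weighted_eval s f) (weighted_eval s' f) (d) => w w' d0 a b i *; lra.
Qed.

(** Adding [t] times the section at [x] to a near minimizer cannot lower [Q] below its infimum. The
    resulting quadratic in [t] is nonnegative, and its discriminant bounds the first-order term. *)
Lemma riesz_stationary s (e : R) x : Q s <= d + e ->
  (kernel_comb s x - f x) ^+ 2 <= e * K x x.
Proof.
move=> h; have kx : 0 <= K x x.
  by rewrite -sqnorm_section; apply: sqnorm_ge0 => //; exact: (rkhs_section hH).
apply: quadratic_discriminant => // t.
have := d_le ([seq (t * p.1, p.2) | p <- [:: (1, x)]] ++ s).
have E1 : kernel_comb [:: (1, x)] = K x by rewrite /kernel_comb big_seq1 scale1r.
have E2 : weighted_eval [:: (1, x)] f = f x by rewrite /weighted_eval big_seq1 mul1r.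
rewrite /Q kernel_combD weighted_evalD E1 E2 sqnormDZ //; last exact: (rkhs_section hH).
rewrite (ipC hilb (rkhs_section hH x) (kernel_comb_mem s)) -(rkhs_reproducing hH) //.
by rewrite sqnorm_section; move: h; rewrite /Q; lra.
Qed.

(** A minimizing sequence is Cauchy, hence has a norm limit, which is also a pointwise limit. By
    [riesz_stationary] its pointwise limit is [f]. Taken with M = |f|^2 for a member [f], the second
    part is the density of the combinations of sections. *)
Lemma riesz_representation : mem f /\ exists s : nat -> seq (R * T),
  (fun k => sqnorm H (kernel_comb (s k) - f)) @ \oo --> (0 : R).
Proof.
have : forall k : nat, exists s, Q s <= d + k.+1%:R^-1.
  move=> k; have k0 : 0 < k.+1%:R^-1 :> R by rewrite invr_gt0.
  by have [_ [s _ <-] /ltW] := inf_adherent k0 has_infQ; exists s.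
move=> /choice[s hs].
have cs : (fun k : nat => k.+1%:R^-1 : R) @ \oo --> (0 : R) by exact: cvg_harmonic.
have [k|e e0|g hg cg] := @hilbert_complete_sqr _ _ H hilb (fun k => kernel_comb (s k)).
- exact: kernel_comb_mem.
- have e8 : 0 < e / 8 by lra.
  move/cvgrPdist_le: cs => /(_ _ e8)[N _ hN].
  have Qe k : (N <= k)%N -> Q (s k) <= d + e / 8.
    move=> Nk; apply: le_trans (hs k) _; rewrite lerD2l.
    by apply: le_trans (hN k Nk); rewrite sub0r normrN ler_norm.
  exists N => p q Np Nq; apply: le_lt_trans (riesz_minimizing_close (Qe p Np) (Qe q Nq)) _.
  lra.
suff fg : f = g by rewrite fg; split => //; exists s.
apply/funext => x.
have c1 : (fun k => kernel_comb (s k) x) @ \oo --> f x.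
  apply/subr_cvg0; apply: (@cvg0_of_sqr_le _ _ (fun k => k.+1%:R^-1 * K x x)).
    by move=> k; exact: riesz_stationary.
  by rewrite -(mul0r (K x x)); apply: cvgM => //; exact: cvg_cst.
have c2 : (fun k => kernel_comb (s k) x) @ \oo --> g x.
  apply/subr_cvg0; apply: (@cvg0_of_sqr_le _ _
    (fun k => sqnorm H (kernel_comb (s k) - g) * K x x)).
    by move=> k; apply: (@rkhs_eval_le (kernel_comb (s k) - g)); exact: hilbert_sub.
  by rewrite -(mul0r (K x x)); apply: cvgM => //; exact: cvg_cst.
exact: (cvg_unique _ c1 c2).
Qed.

(** Along the approximating combinations the hypothesis on [M] tends to |f|^4 <= M |f|^2. *)
Lemma rkhs_norm_le : sqnorm H f <= M.
Proof.
have [hf [s cs]] := riesz_representation.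
have hk k : mem (kernel_comb (s k)) by [].
have c1 := ip_cvg hilb hk hf hf cs; have c2 := sqnorm_cvg hilb hk hf cs.
have : sqnorm H f * sqnorm H f <= M * sqnorm H f.
  apply: (ler_cvg_to (cvgM c1 c1) (cvgM (cvg_cst M) c2)); apply: nearW => k.
  by rewrite /= (ipC hilb (hk k) hf) ip_kernel_comb // -expr2; exact: fM.
have := sqnorm_ge0 hilb hf; rewrite le_eqVlt => /predU1P[<- //|f0].
by rewrite ler_pM2r.
Qed.

End Riesz.
End RKHS.

(** * Expansions on the ball *)

Lemma cvgn_nneseries (R : realType) (a : nat -> R) : (forall l, 0 <= a l) ->
  (\sum_(0 <= l <oo) (a l)%:E < +oo)%E -> cvgn (series a).
Proof.
move=> a0 fin; apply: nondecreasing_is_cvgn.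
  by apply/nondecreasing_seqP => L; rewrite seriesSr lerDl.
exists (fine (\sum_(0 <= l <oo) (a l)%:E)%E) => _ [L _ <-].
rewrite -lee_fin fineK.
  by rewrite -sumEFin; apply: nneseries_lim_ge => l _ _; rewrite lee_fin.
by rewrite ge0_fin_numE // nneseries_ge0 // => l _ _; rewrite lee_fin.
Qed.

Lemma nneseries_EFin (R : realType) (a : nat -> R) : cvgn (series a) ->
  (\sum_(0 <= l <oo) (a l)%:E = (limn (series a))%:E)%E.
Proof.
move=> ca; apply/cvg_lim => //; rewrite [X in X @ _ --> _](_ : _ = EFin \o series a).
  by apply: cvg_EFin => //; exact: nearW.
by apply/funext => L; rewrite /= sumEFin.
Qed.

Lemma cvg_sumr (R : realType) (J : Type) (w : seq J) (u : J -> nat -> R) (v : J -> R) :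
  (forall j, u j @ \oo --> v j) ->
  (fun q => \sum_(j <- w) u j q) @ \oo --> \sum_(j <- w) v j.
Proof.
move=> hu; elim: w => [|j w IH].
  by under eq_fun do rewrite big_nil; rewrite big_nil; exact: cvg_cst.
by under eq_fun do rewrite big_cons; rewrite big_cons; exact: cvgD.
Qed.

Section PolarCoordinates.
Variables (R : realType) (m : nat).
Local Notation S := (sphere R m.+2).

Lemma unit_itv0_subproof : (0 : R) \in @unit_itv_set R.
Proof. by rewrite inE /unit_itv_set /= lexx ler01. Qed.

Definition unit_itv0 : unit_itv R := exist _ (0 : R) unit_itv0_subproof.

Lemma polar0 (t t' : S) : polar unit_itv0 t = polar unit_itv0 t'.
Proof. by apply: val_inj; rewrite /= !scale0r. Qed.

Lemma polar_surj (x : cball R m.+2) : exists p : unit_itv R * S, polar p.1 p.2 = x.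
Proof.
have /set_mem /= hx := valP x.
pose r := Num.sqrt (dot (\val x) (\val x)).
have r_in : r \in @unit_itv_set R by rewrite inE /unit_itv_set /= sqrtr_ge0.
have d0 : 0 <= dot (\val x) (\val x).
  by rewrite /dot mxE sumr_ge0 // => i _; rewrite mxE -expr2 sqr_ge0.
have [r0|r0] := eqVneq r 0.
  exists (unit_itv0, sphere_first R m); apply: val_inj; rewrite /= scale0r.
  apply/esym/matrixP => i j; rewrite ord1 mxE.
  have : dot (\val x) (\val x) == 0 by rewrite eq_le d0 andbT -sqrtr_eq0 -/r r0 eqxx.
  rewrite /dot mxE psumr_eq0 => [/allP/(_ i)|k _]; last by rewrite mxE -expr2 sqr_ge0.
  by rewrite mem_index_enum mxE -expr2 sqrf_eq0 => /(_ isT) /eqP.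
have t_in : r^-1 *: \val x \in @sphere_set R m.+2.
  rewrite inE /sphere_set /= dotZZ -[dot _ _]sqr_sqrtr // -exprMn mulVf //.
  by rewrite expr1n sqrtr1.
exists (exist _ (r : R) r_in, exist _ (r^-1 *: \val x) t_in).
by apply: val_inj; rewrite /= scalerA divff // scale1r.
Qed.

Lemma polar_inj (r r' : unit_itv R) (t t' : S) : polar r t = polar r' t' ->
  r = r' /\ (r = unit_itv0 \/ t = t').
Proof.
move=> /(congr1 val) /= E.
have /set_mem /= /andP[r0 _] := valP r; have /set_mem /= /andP[r0' _] := valP r'.
have rr : \val r = \val r'.
  have := congr1 (fun x => dot x x) E; rewrite !dotZZ !dot_sphere !mulr1 => /eqP.
  by rewrite eqrXn2 // => /eqP.
split; first exact: val_inj.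
have [rz|rz] := eqVneq (\val r) 0; first by left; exact: val_inj.
right; apply: val_inj; apply: (scalerI rz); rewrite E rr //.
Qed.
End PolarCoordinates.

(** * Coefficient families and the RKHS of K *)

Section Expansion.
Variables (R : realType) (m : nat).
Local Notation n := m.+2.
Local Notation S := (sphere R n).
Local Notation D := (cball R n).
Local Notation I := (unit_itv R).
Local Notation Harm := (@spherical_harmonics R n).
Variables (C : nat -> {poly R}) (hC : is_gegenbauer (n%:R / 2 - 1) C).
Variables (K : D -> D -> R) (c : nat -> I -> I -> R).
Hypothesis hKc : forall (r1 r2 : I) (t1 t2 : S),
  series (fun l => c l r1 r2 * (C l).[dot (\val t1) (\val t2)]) @ \oo
    --> K (polar r1 t1) (polar r2 t2).
Variable Y : forall l : nat, 'I_(Nharm R n l) -> S -> R.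
Hypothesis hY : forall l, is_L2_orthonormal_basis (Harm l) (@Y l).
Variables (HK : ip_space R D) (hHK : is_rkhs K HK).
Variables (Hc : nat -> ip_space R I) (hHc : forall l, is_rkhs (c l) (Hc l)).
Implicit Types (h : coef_family R n) (s : seq (R * (I * S))) (r : I) (t : S).

Let mu l := gegenbauer_p (n%:R / 2 - 1) C l * sphere_area R (n - 2).
Let hilb l := rkhs_hilbert (hHc l).

Lemma mu_gt0 l : 0 < mu l.
Proof.
have [+ _] := addition_theorem hC hY l.
by rewrite /mu !subSS subn0.
Qed.

Lemma additionE l (u t : S) : (C l).[dot (\val u) (\val t)] =
  mu l * \sum_k @Y l k u * @Y l k t.
Proof.
have [_ ->] := addition_theorem hC hY l.
by rewrite /mu !subSS subn0.
Qed.

Lemma addition_diag l t : mu l * \sum_k @Y l k t * @Y l k t = 1.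
Proof. by rewrite -additionE dot_sphere; case: hC. Qed.

Definition term h l r t := \sum_k h l k r * @Y l k t.

Definition energy h l := \sum_k sqnorm (Hc l) (h l k) / mu l.

Definition inner h h' l := \sum_k ip (Hc l) (h l k) (h' l k) / mu l.

Definition mem_family h := forall l k, carrier (Hc l) (h l k).

Definition family_lin (a : R) h h' : coef_family R n := fun l k => a *: h l k + h' l k.

(* By the addition theorem, the coefficients of the combination of sections of K
   with weights and points s. *)
Definition section_family s : coef_family R n :=
  fun l k => \sum_(p <- s) (mu l * p.1 * @Y l k p.2.2) *: c l p.2.1.

Definition ball_points s : seq (R * D) := [seq (p.1, polar p.2.1 p.2.2) | p <- s].

Lemma mem_family_lin a h h' : mem_family h -> mem_family h' ->
  mem_family (family_lin a h h').
Proof. by move=> hh hh' l k; apply: hilbertD. Qed.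

Lemma mem_section_family s : mem_family (section_family s).
Proof.
move=> l k; apply: hilbert_sum => // p; apply: hilbertZ => //.
exact: (rkhs_section (hHc l)).
Qed.
Hint Resolve mem_section_family : core.

Lemma energy_ge0 h l : mem_family h -> 0 <= energy h l.
Proof.
move=> hh; apply: sumr_ge0 => k _; rewrite divr_ge0 ?(ltW (mu_gt0 l)) //.
exact: sqnorm_ge0 (hilb l) _ (hh l k).
Qed.

Lemma energy_lin a h h' l : mem_family h -> mem_family h' ->
  energy (family_lin a h h') l = a ^+ 2 * energy h l + 2 * a * inner h h' l + energy h' l.
Proof.
move=> hh hh'; rewrite !mulr_sumr -!big_split; apply: eq_bigr => k _ /=.
by rewrite sqnormDZ //; ring.
Qed.

(** The reproducing property for coefficient families: the factor [mu l] put in [section_family]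
    cancels the weight of the inner product. *)
Lemma inner_section h s l : mem_family h ->
  inner h (section_family s) l = \sum_(p <- s) p.1 * term h l p.2.1 p.2.2.
Proof.
move=> hh; transitivity (\sum_k \sum_(p <- s) p.1 * (h l k p.2.1 * @Y l k p.2.2)).
  apply: eq_bigr => k _; rewrite ip_sumr //; last by move=> p;
    exact: (rkhs_section (hHc l)).
  rewrite mulr_suml; apply: eq_bigr => p _; rewrite -(rkhs_reproducing (hHc l)) //.
  by have := mu_gt0 l; move: (mu l) => x x0; field; rewrite gt_eqF.
by rewrite exchange_big; apply: eq_bigr => p _; rewrite mulr_sumr.
Qed.

Lemma term_section s l r t : term (section_family s) l r t =
  \sum_(p <- s) p.1 * (c l p.2.1 r * (C l).[dot (\val p.2.2) (\val t)]).
Proof.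
rewrite /term; under eq_bigr => k _ do rewrite /section_family fct_sumE mulr_suml.
rewrite exchange_big; apply: eq_bigr => p _; rewrite additionE !mulr_sumr.
by apply: eq_bigr => k _; rewrite -[(_ *: _) r]/(mu l * p.1 * @Y l k p.2.2 * c l p.2.1 r); ring.
Qed.

Lemma energyE h l : energy h l = inner h h l.
Proof. by []. Qed.

Lemma series_sum (J : Type) (w : seq J) (a : J -> R) (u : J -> nat -> R) (v : J -> R) :
  (forall j, series (u j) @ \oo --> v j) ->
  series (fun l => \sum_(j <- w) a j * u j l) @ \oo --> \sum_(j <- w) a j * v j.
Proof.
move=> hu; have -> : series (fun l => \sum_(j <- w) a j * u j l) =
    fun L => \sum_(j <- w) a j * series (u j) L.
  apply/funext => L; rewrite /series /= exchange_big; apply: eq_bigr => j _.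
  by rewrite mulr_sumr.
by apply: cvg_sumr => j; apply: cvgM; [exact: cvg_cst|exact: hu].
Qed.

Lemma section_expansion s :
  is_expansion Y (section_family s) (kernel_comb K (ball_points s)).
Proof.
move=> r t; rewrite /kernel_comb fct_sumE big_map.
have -> : series (fun l => \sum_k @section_family s l k r * @Y l k t) =
    series (fun l => \sum_(p <- s) p.1 * (c l p.2.1 r * (C l).[dot (\val p.2.2) (\val t)])).
  by congr series; apply/funext => l; rewrite -term_section.
exact: series_sum.
Qed.

Lemma weighted_eval_points s f :
  weighted_eval (ball_points s) f = \sum_(p <- s) p.1 * f (polar p.2.1 p.2.2).
Proof. by rewrite /weighted_eval big_map. Qed.

(** Both sides evaluate the combination at its own points with its own weights, degree by degree on
    the left and in [HK] on the right. Hence passing to coefficients is isometric on combinations of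
    sections. *)
Lemma energy_section_cvg s : series (energy (section_family s)) @ \oo -->
  sqnorm HK (kernel_comb K (ball_points s)).
Proof.
rewrite /sqnorm ip_kernel_comb //; last exact: kernel_comb_mem.
rewrite weighted_eval_points.
have -> : series (energy (section_family s)) = series (fun l =>
    \sum_(p <- s) p.1 * term (section_family s) l p.2.1 p.2.2).
  by congr series; apply/funext => l; rewrite energyE inner_section.
by apply: series_sum => p; exact: section_expansion.
Qed.

Lemma series_energy_le h (L : nat) (W : R) : mem_family h ->
  series (energy h) @ \oo --> W -> series (energy h) L <= W.
Proof.
move=> hh cW; rewrite -(cvg_lim _ cW) //; apply: nondecreasing_cvgn_le.
  by apply/nondecreasing_seqP => l; rewrite seriesSr lerDl energy_ge0.
by apply/cvg_ex; exists W.
Qed.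

Lemma series_energy_lin a h h' L : mem_family h -> mem_family h' ->
  series (energy (family_lin a h h')) L = a ^+ 2 * series (energy h) L +
    2 * a * series (inner h h') L + series (energy h') L.
Proof.
move=> hh hh'; rewrite /series /= !mulr_sumr -!big_split; apply: eq_bigr => l _.
by rewrite energy_lin.
Qed.

Lemma series_energy_ge0 h L : mem_family h -> 0 <= series (energy h) L.
Proof. by move=> hh; apply: sumr_ge0 => l _; exact: energy_ge0. Qed.

Lemma inner_cauchy_schwarz h h' L : mem_family h -> mem_family h' ->
  series (inner h h') L ^+ 2 <= series (energy h') L * series (energy h) L.
Proof.
move=> hh hh'; apply: quadratic_discriminant => [|x]; first exact: series_energy_ge0.
have := series_energy_ge0 L (mem_family_lin x hh hh').
by rewrite series_energy_lin //; lra.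
Qed.

(** Positivity of the energy of [h] plus or minus the family of the section at [(r, t)], whose
    energy is [c l r r]. The bound does not involve [t], which gives uniform convergence on each
    sphere of radius [r]. *)
Lemma term_bound h l r t : mem_family h ->
  `|term h l r t| <= 2^-1 * (energy h l + c l r r).
Proof.
move=> hh; pose s := [:: (1 : R, (r, t))].
have E : inner h (section_family s) l = term h l r t.
  by rewrite inner_section // big_seq1 mul1r.
have E1 : energy (section_family s) l = c l r r.
  rewrite energyE inner_section // big_seq1 mul1r term_section big_seq1 mul1r /=.
  by rewrite dot_sphere; case: hC => _ _ ->; rewrite mulr1.
have := energy_ge0 l (mem_family_lin 1 hh (mem_section_family s)).
have := energy_ge0 l (mem_family_lin (-1) hh (mem_section_family s)).
rewrite !energy_lin // E E1 ler_norml => h1 h2; apply/andP; split; lra.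
Qed.

Lemma diag_cvg r : exists v, series (fun l => c l r r) @ \oo --> (v : R).
Proof.
exists (K (polar r (sphere_first R m)) (polar r (sphere_first R m))).
have := @hKc r r (sphere_first R m) (sphere_first R m).
have -> // : (fun l => c l r r * (C l).[dot (\val (sphere_first R m))
  (\val (sphere_first R m))]) =
  fun l => c l r r.
by apply/funext => l; rewrite dot_sphere; case: hC => _ _ ->; rewrite mulr1.
Qed.

Lemma diag_ge0 l r : 0 <= c l r r.
Proof.
by rewrite -(sqnorm_section (hHc l)); apply: sqnorm_ge0 => //;
  exact: (rkhs_section (hHc l)).
Qed.

Lemma term_summable h (W : R) r : mem_family h -> series (energy h) @ \oo --> W ->
  cvgn (series (fun l => 2^-1 * (energy h l + c l r r))).
Proof.
move=> hh cW; have [v cv] := diag_cvg r; apply/cvg_ex; exists (2^-1 * (W + v)).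
have -> : series (fun l => 2^-1 * (energy h l + c l r r)) =
    fun L => 2^-1 * (series (energy h) L + series (fun l => c l r r) L).
  by apply/funext => L; rewrite /series /= -mulr_sumr big_split.
by apply: cvgM; [exact: cvg_cst|exact: cvgD].
Qed.

Lemma sphere_integral_harmonic l f : Harm l f -> (0 < l)%N -> sphere_integral f = 0.
Proof.
move=> hf l0; have h1 : Harm 0%N (fun=> 1).
  exact: ZonalHarmonics.harmonic_restriction_cst.
rewrite -[RHS](harmonic_orthogonal hf h1) -?lt0n //.
by congr sphere_integral; apply/funext => t; rewrite mulr1.
Qed.

(** At radius 0 the kernel expansion is a harmonic series in [t] whose sum is constant, because all
    directions give the same point. Its coefficients are therefore those of a constant, and
    harmonics of positive degree integrate to zero. *)
Lemma kernel_origin l : (0 < l)%N -> c l (unit_itv0 R) (unit_itv0 R) = 0.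
Proof.
move=> l0; pose o := unit_itv0 R; pose e := sphere_first R m.
pose d l (k : 'I_(Nharm R n l)) := mu l * c l o o * @Y l k e.
have dE l1 t : \sum_k @d l1 k * @Y l1 k t = c l1 o o * (C l1).[dot (\val e) (\val t)].
  rewrite additionE !mulr_sumr; apply: eq_bigr => k _; rewrite /d; ring.
(* From the sums of squares of [Y k e - Y k t] and [Y k e + Y k t], as the diagonal of the addition
   formula is 1. *)
have C_le1 l1 t : `|(C l1).[dot (\val e) (\val t)]| <= 1.
  have h x y : (x - y) ^+ 2 = x * x - 2 * (x * y) + y * y :> R by ring.
  have h' x y : (x + y) ^+ 2 = x * x + 2 * (x * y) + y * y :> R by ring.
  have := addition_diag l1 e; have := addition_diag l1 t; rewrite additionE.
  have : 0 <= mu l1 * \sum_k (@Y l1 k e - @Y l1 k t) ^+ 2.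
    by rewrite mulr_ge0 ?(ltW (mu_gt0 l1)) // sumr_ge0 // => k _; exact: sqr_ge0.
  have : 0 <= mu l1 * \sum_k (@Y l1 k e + @Y l1 k t) ^+ 2.
    by rewrite mulr_ge0 ?(ltW (mu_gt0 l1)) // sumr_ge0 // => k _; exact: sqr_ge0.
  under eq_bigr => k _ do rewrite h'.
  under [X in _ -> 0 <= _ * X -> _]eq_bigr => k _ do rewrite h.
  rewrite !big_split /= sumrN -!mulr_sumr ler_norml.
  move=> *; apply/andP; split; lra.
have [v cv] := diag_cvg o.
have cb : cvgn (series (fun l => c l o o)) by apply/cvg_ex; exists v.
have db l1 t : `|\sum_k @d l1 k * @Y l1 k t| <= c l1 o o.
  by rewrite dE normrM ger0_norm ?diag_ge0 // ler_piMr ?diag_ge0.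
have dv t : series (fun l => \sum_k @d l k * @Y l k t) @ \oo --> K (polar o e) (polar o e).
  have -> : (fun l => \sum_k @d l k * @Y l k t) =
      fun l => c l o o * (C l).[dot (\val e) (\val t)] by apply/funext.
  by rewrite {2}/o {2}(polar0 e t); exact: hKc.
have d0 k : @d l k = 0.
  rewrite (harmonic_coefficients hY cb db dv) (sphere_integral_harmonic _ l0) ?mulr0 //.
  by case: (hY l) => -[].
have := dE l e; rewrite dot_sphere big1 => [|k _]; last by rewrite d0 mul0r.
by case: hC => _ _ ->; rewrite mulr1.
Qed.

(** Degree 0 harmonics are constant, and in positive degree the bound |h(0)|^2 <= |h|^2 c_l(0, 0)
    makes the radial factor vanish. This makes the sum of a series well defined at the centre. *)
Lemma term_origin h l t t' : mem_family h ->
  term h l (unit_itv0 R) t = term h l (unit_itv0 R) t'.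
Proof.
move=> hh; apply: eq_bigr => k _; case: l k => [|l] k.
  have hk : Harm 0%N (@Y 0%N k) by case: (hY 0) => -[].
  by have [x Yx] := ZonalHarmonics.harmonic_restriction0 hk; rewrite !Yx.
have := rkhs_eval_le (hHc l.+1) (unit_itv0 R) (hh l.+1 k).
rewrite kernel_origin // mulr0 => h0.
have -> : h l.+1 k (unit_itv0 R) = 0.
  by apply/eqP; rewrite -sqrf_eq0 eq_le h0 sqr_ge0.
by rewrite !mul0r.
Qed.

Lemma expansion_exists h (W : R) : mem_family h -> series (energy h) @ \oo --> W ->
  exists f, is_expansion Y h f.
Proof.
move=> hh cW; have [P PE] := choice (@polar_surj R m).
exists (fun x => limn (series (fun l => term h l (P x).1 (P x).2))) => r t.
have tc r' t' : cvgn (series (fun l => term h l r' t')).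
  apply: normed_cvg.
  apply: (series_le_cvg (v_ := fun l => 2^-1 * (energy h l + c l r' r'))) => [l|l|l|].
  - exact: normr_ge0.
  - exact: le_trans (normr_ge0 _) (term_bound l r' t' hh).
  - exact: term_bound.
  - exact: term_summable cW.
(* The chosen polar coordinates can differ from [(r, t)] only at the centre, where the terms ignore
   the direction. *)
have [rE tE] := polar_inj (PE (polar r t)).
suff -> : (fun l => term h l (P (polar r t)).1 (P (polar r t)).2) =
    fun l => term h l r t by exact: tc.
apply/funext => l; rewrite rE; case: tE => [|-> //]; rewrite rE => ->.
exact: term_origin.
Qed.

Lemma expansion_in_rkhs h f (W : R) : mem_family h -> series (energy h) @ \oo --> W ->
  is_expansion Y h f -> carrier HK f /\ sqnorm HK f <= W.
Proof.
move=> hh cW hf; have [P PE] := choice (@polar_surj R m).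
have W0 : 0 <= W.
  by apply: le_trans (series_energy_le 0 hh cW); exact: series_energy_ge0.
have fW (w : seq (R * D)) : weighted_eval w f ^+ 2 <= W * sqnorm HK (kernel_comb K w).
  pose s' := [seq (p.1, P p.2) | p <- w].
  have -> : w = ball_points s'.
    rewrite /ball_points -map_comp -[LHS]map_id; apply: eq_map => p /=.
    by rewrite PE -surjective_pairing.
  have c1 : series (inner h (section_family s')) @ \oo --> weighted_eval (ball_points s') f.
    have -> : inner h (section_family s') =
        fun l => \sum_(p <- s') p.1 * term h l p.2.1 p.2.2.
      by apply/funext => l; rewrite inner_section.
    by rewrite weighted_eval_points; apply: series_sum => p; exact: hf.
  have c2 := @energy_section_cvg s'.
  rewrite expr2 [leRHS]mulrC; apply: (ler_cvg_to (cvgM c1 c1) (cvgM c2 cW)).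
  by apply: nearW => L; rewrite /= -expr2; exact: inner_cauchy_schwarz.
split; first by have [] := riesz_representation hHK fW W0.
exact: (rkhs_norm_le hHK fW W0).
Qed.

Lemma expansion_unique h f (W : R) : mem_family h -> series (energy h) @ \oo --> W ->
  is_expansion Y h f -> (forall x, f x = 0) -> forall l k, h l k = 0.
Proof.
move=> hh cW hf f0 l k; apply/funext => r.
rewrite (@harmonic_coefficients R m Y hY (fun l k => h l k r) _ 0 (@term_summable h W r hh cW)).
- by rewrite mul0r.
- by move=> l' t; exact: term_bound.
- by move=> t; rewrite -[X in _ --> X](f0 (polar r t)); exact: hf.
Qed.

Lemma expansion_lin a h h' f f' : is_expansion Y h f -> is_expansion Y h' f' ->
  is_expansion Y (family_lin a h h') (a *: f + f').
Proof.
move=> hf hf' r t.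
have -> : series (fun l => \sum_k family_lin a h h' k r * @Y l k t) =
    fun L => a * series (fun l => term h l r t) L + series (fun l => term h' l r t) L.
  apply/funext => L; rewrite /series /= mulr_sumr -big_split; apply: eq_bigr => l _.
  rewrite /= mulr_sumr -big_split; apply: eq_bigr => k _ /=.
  by rewrite -[family_lin _ _ _ _ _]/(a * h l k r + h' l k r); ring.
by apply: cvgD; [apply: cvgM; [exact: cvg_cst|exact: hf]|exact: hf'].
Qed.

Lemma section_familyD a s s' : section_family ([seq (a * p.1, p.2) | p <- s] ++ s') =
  family_lin a (section_family s) (section_family s').
Proof.
apply/functional_extensionality_dep => l; apply/funext => k.
rewrite /section_family /family_lin big_cat big_map scaler_sumr; congr (_ + _).
by apply: eq_bigr => p _; rewrite scalerA; congr (_ *: _); rewrite /=; ring.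
Qed.

Lemma ball_pointsD a s s' : ball_points ([seq (a * p.1, p.2) | p <- s] ++ s') =
  [seq (a * p.1, p.2) | p <- ball_points s] ++ ball_points s'.
Proof. by rewrite /ball_points map_cat -!map_comp. Qed.

(** Limits are taken coefficient by coefficient in each [Hc l], so completeness of the weighted
    direct sum is not invoked. Bounds on partial energies pass to the limit as in Fatou's lemma;
    keeping an arbitrary combination [s'] in them yields both the norm bound and the identification
    of the sum with [f]. *)
Lemma rkhs_expansion f : carrier HK f -> exists h (W : R),
  [/\ mem_family h, series (energy h) @ \oo --> W, W <= sqnorm HK f & is_expansion Y h f].
Proof.
move=> hf; have hilbK := rkhs_hilbert hHK; have [P PE] := choice (@polar_surj R m).
have [_ [s0 cs0]] := riesz_representation hHK (fun w : seq (R * D) => rkhs_bounded hHK w hf)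
  (sqnorm_ge0 hilbK hf).
pose s k := [seq (p.1, P p.2) | p <- s0 k].
have s0E k : s0 k = ball_points (s k).
  rewrite /ball_points -map_comp -[LHS]map_id; apply: eq_map => p /=.
  by rewrite PE -surjective_pairing.
pose g k := kernel_comb K (ball_points (s k)).
have cg : (fun k => sqnorm HK (g k - f)) @ \oo --> (0 : R).
  by under eq_fun do rewrite /g -s0E; exact: cs0.
have hg k : carrier HK (g k) by exact: kernel_comb_mem.
pose F k := section_family (s k).
have diff q s' L : series (energy (family_lin (-1) (section_family s') (F q))) L <=
    sqnorm HK (g q - kernel_comb K (ball_points s')).
  rewrite -section_familyD /g [X in sqnorm _ X]addrC -(scaleN1r (kernel_comb K _))
    -kernel_combD -ball_pointsD.
  by apply: series_energy_le => //; exact: energy_section_cvg.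
have lim l k : exists2 x, carrier (Hc l) x &
    (fun q => sqnorm (Hc l) (F q l k - x)) @ \oo --> (0 : R).
  apply: (hilbert_complete_sqr (hilb l)) => [q|e e0]; first exact: mem_section_family.
  (* The energy weights a coefficient by the inverse of [mu l], and comparing two approximations
     through [f] costs a factor 4. *)
  have e4 : 0 < e / mu l / 4 by rewrite divr_gt0 // divr_gt0 ?mu_gt0.
  move/cvgrPdist_lt: cg => /(_ _ e4)[N _ hN]; exists N => p q Np Nq.
  have hN' i : (N <= i)%N -> sqnorm HK (g i - f) < e / mu l / 4.
    by move=> Ni; apply: le_lt_trans (hN i Ni); rewrite sub0r normrN ler_norm.
  have h1 : sqnorm (Hc l) (F p l k - F q l k) / mu l <= sqnorm HK (g p - g q).
    apply: le_trans (diff p (s q) l.+1); rewrite seriesSr.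
    have hpq := mem_family_lin (-1) (mem_section_family (s q)) (mem_section_family (s p)).
    apply: (@le_trans _ _ (energy (family_lin (-1) (F q) (F p)) l)); last first.
      by rewrite lerDr series_energy_ge0.
    have -> : F p l k - F q l k = family_lin (-1) (F q) (F p) k.
      by rewrite /family_lin addrC scaleN1r.
    rewrite /energy (bigD1 k) //= lerDl sumr_ge0 // => j _.
    by rewrite divr_ge0 ?(ltW (mu_gt0 l)) //; exact: sqnorm_ge0 (hilb l) _ (hpq l j).
  have h2 : sqnorm HK (g p - g q) < e / mu l.
    rewrite (_ : g p - g q = (g p - f) + (f - g q)); last by rewrite addrA subrK.
    apply: le_lt_trans (sqnorm_parallelogram_le hilbK _ _) _; try exact: hilbert_sub.
    rewrite (sqnormBC hilbK hf (hg q)).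
    by have := hN' p Np; have := hN' q Nq; lra.
  by have := le_lt_trans h1 h2; rewrite ltr_pM2r // invr_gt0 mu_gt0.
pose h : coef_family R n := fun l k => sval (cid2 (lim l k)).
have hh : mem_family h by move=> l k; rewrite /h; case: cid2.
have hc l k : (fun q => sqnorm (Hc l) (F q l k - h l k)) @ \oo --> (0 : R).
  by rewrite /h; case: cid2.
(* For fixed [L] the partial energy is a finite sum, hence continuous in the coefficients; [q] tends
   to infinity before [L] does. *)
have energy_le s' L : series (energy (family_lin (-1) (section_family s') h)) L <=
    sqnorm HK (f - kernel_comb K (ball_points s')).
  have hs' := mem_section_family s'.
  have c1 : (fun q => series (energy (family_lin (-1) (section_family s')
    (F q))) L) @ \oo -->
      series (energy (family_lin (-1) (section_family s') h)) L.
    apply: cvg_sumr => l; apply: cvg_sumr => k; apply: cvgM; last exact: cvg_cst.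
    apply: (sqnorm_cvg (hilb l)) => [q||].
    - exact: (mem_family_lin (-1) hs' (mem_section_family (s q)) (l := l) k).
    - exact: (mem_family_lin (-1) hs' hh (l := l) k).
    - under eq_fun do rewrite /family_lin opprD addrACA subrr add0r.
      exact: hc.
  have c2 : (fun q => sqnorm HK (g q - kernel_comb K (ball_points s'))) @ \oo -->
      sqnorm HK (f - kernel_comb K (ball_points s')).
    have hks' := kernel_comb_mem hHK (ball_points s').
    apply: (sqnorm_cvg hilbK) => [q||].
    - exact: hilbert_sub.
    - exact: hilbert_sub.
    - by under eq_fun do rewrite opprB addrA subrK; exact: cg.
  by apply: (ler_cvg_to c1 c2); apply: nearW => q; exact: diff.
have energy_cvg s' : exists2 W, series (energy (family_lin (-1)
  (section_family s') h)) @ \oo --> W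
    & W <= sqnorm HK (f - kernel_comb K (ball_points s')).
  have cv : cvgn (series (energy (family_lin (-1) (section_family s') h))).
    apply: nondecreasing_is_cvgn.
      apply/nondecreasing_seqP => l; rewrite seriesSr lerDl energy_ge0 //.
      exact: mem_family_lin.
    by exists (sqnorm HK (f - kernel_comb K (ball_points s'))) => _ [L _ <-].
  exists (limn (series (energy (family_lin (-1) (section_family s') h)))) => //.
  by apply: limr_le => //; apply: nearW => L; exact: energy_le.
(* The empty combination bounds the energy of [h] by |f|^2. *)
have [W cW Wf] := energy_cvg [::].
have lin0 : family_lin (-1) (section_family [::]) h = h.
  apply/functional_extensionality_dep => l; apply/funext => k.
  by rewrite /family_lin /section_family big_nil scaler0 add0r.
rewrite lin0 in cW; rewrite /ball_points /kernel_comb big_nil subr0 in Wf.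
exists h, W; split=> //.
have [F0 hF0] := expansion_exists hh cW.
(* With [s' = s k], the distance from [g k] to the sum [F0] of [h] is at most that from [g k] to
   [f]. So [g k] converges to both functions. *)
suff <- : F0 = f by [].
have [F0K _] := expansion_in_rkhs hh cW hF0.
apply: (hilbert_cvg_unique hilbK hg F0K hf _ cg).
apply: (@squeeze_cvgr _ _ _ _ (fun=> 0) (fun k => sqnorm HK (g k - f))) => //;
  last exact: cvg_cst.
apply: nearW => k; rewrite sqnorm_ge0 //=; last exact: hilbert_sub.
have [V cV Vf] := energy_cvg (s k).
have hV := mem_family_lin (-1) (mem_section_family (s k)) hh.
have [_] := expansion_in_rkhs hV cV (expansion_lin (a := -1)
  (@section_expansion (s k)) hF0).
rewrite scaleN1r addrC => h1; rewrite (sqnormBC hilbK (hg k) F0K)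
  (sqnormBC hilbK (hg k) hf).
exact: le_trans h1 Vf.
Qed.

Lemma weighted_sumE h : weighted_sum C Hc h = (\sum_(0 <= l <oo) (energy h l)%:E)%E.
Proof. by apply: eq_eseriesr => l _; rewrite sumEFin. Qed.

Lemma weighted_sum_cvg h (W : R) : series (energy h) @ \oo --> W ->
  weighted_sum C Hc h = W%:E.
Proof.
move=> cW; rewrite weighted_sumE nneseries_EFin; last by apply/cvg_ex; exists W.
by congr EFin; exact: cvg_lim.
Qed.

Lemma admissible_cvg h : admissible C Hc h ->
  mem_family h /\ exists W : R, series (energy h) @ \oo --> W.
Proof.
move=> [hh]; rewrite weighted_sumE => fin; split=> //; apply/cvg_ex.
by apply: cvgn_nneseries fin => l; exact: energy_ge0.
Qed.

Lemma family_cvg_sub h h' (W W' : R) : mem_family h -> mem_family h' ->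
  series (energy h) @ \oo --> W -> series (energy h') @ \oo --> W' ->
  exists V : R, series (energy (family_lin (-1) h h')) @ \oo --> V.
Proof.
move=> hh hh' cW cW'; apply/cvg_ex.
have hd := mem_family_lin (-1) hh hh'.
apply: nondecreasing_is_cvgn.
  by apply/nondecreasing_seqP => l; rewrite seriesSr lerDl energy_ge0.
(* The parallelogram bound, from the positivity of the energy of [h + h']. *)
exists (2 * W + 2 * W') => _ [L _ <-].
have := series_energy_ge0 L (mem_family_lin 1 hh hh').
have := series_energy_le L hh cW; have := series_energy_le L hh' cW'.
rewrite !series_energy_lin //.
by move: (series (inner h h') L) (series (energy h) L) (series (energy h') L) => *; lra.
Qed.

Lemma rkhs_ball_expansion :
  [/\ forall h, admissible C Hc h -> exists f, is_expansion Y h f,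
      carrier HK = [set f | exists2 h, admissible C Hc h & is_expansion Y h f]
    & forall h f, admissible C Hc h -> is_expansion Y h f ->
        (sqnorm HK f)%:E = weighted_sum C Hc h /\ (weighted_sum C Hc h < +oo)%E].
Proof.
split.
- by move=> h /admissible_cvg[hh [W cW]]; exact: expansion_exists cW.
- apply/seteqP; split=> [f /rkhs_expansion[h [W [hh cW _ hf]]]|f [h]].
    by exists h => //; split=> //; rewrite (weighted_sum_cvg cW) ltry.
  by move=> /admissible_cvg[hh [W cW]] /(expansion_in_rkhs hh cW)[].
move=> h f adm hf; have [hh [W cW]] := admissible_cvg adm.
rewrite (weighted_sum_cvg cW) ltry; split=> //; congr EFin.
have [fK fW] := expansion_in_rkhs hh cW hf.
apply/eqP; rewrite eq_le fW /=.
have [h' [W' [hh' cW' Wf hf']]] := rkhs_expansion fK.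
(* The family [h'] satisfies the missing inequality [W' <= sqnorm HK f]; by uniqueness of
   coefficients it is [h]. *)
suff hE : h' = h.
  by move: cW'; rewrite hE => cW'; rewrite (cvg_unique _ cW cW').
have [V cV] := family_cvg_sub hh hh' cW cW'.
have := expansion_unique (mem_family_lin (-1) hh hh') cV (expansion_lin (a := -1) hf hf').
have f0 x : (-1 *: f + f) x = 0 by rewrite scaleN1r addNr.
move=> /(_ f0) h0; apply/functional_extensionality_dep => l; apply/funext => k.
by apply/eqP; rewrite -subr_eq0 addrC -scaleN1r; apply/eqP; exact: h0.
Qed.

End Expansion.

Theorem theorem4p9 (R : realType) (n : nat) (hn : (2 <= n)%N)
  (C : nat -> {poly R}) (hC : is_gegenbauer (n%:R / 2 - 1) C)
  (K : cball R n -> cball R n -> R)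
  (hK : psd_kernel K)
  (hKcont : continuous (fun z : cball R n * cball R n => K z.1 z.2))
  (hKinv : orthogonal_invariant K)
  (c : nat -> unit_itv R -> unit_itv R -> R)
  (hc : forall l, psd_kernel (c l))
  (hccont : forall l,
     continuous (fun r : unit_itv R * unit_itv R => c l r.1 r.2))
  (hKc : forall (r1 r2 : unit_itv R) (t1 t2 : sphere R n),
     series (fun l => c l r1 r2 * (C l).[dot (\val t1) (\val t2)]) @ \oo
       --> K (polar r1 t1) (polar r2 t2))
  (Y : forall l : nat, 'I_(Nharm R n l) -> sphere R n -> R)
  (hY : forall l, is_L2_orthonormal_basis (@spherical_harmonics R n l) (Y l))
  (HK : ip_space R (cball R n)) (hHK : is_rkhs K HK)
  (Hc : nat -> ip_space R (unit_itv R)) (hHc : forall l, is_rkhs (c l) (Hc l)) :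
  [/\ forall h : coef_family R n, admissible C Hc h ->
        exists f : cball R n -> R, is_expansion Y h f,
      carrier HK =
        [set f | exists2 h : coef_family R n,
                   admissible C Hc h & is_expansion Y h f]
    & forall (h : coef_family R n) (f : cball R n -> R),
        admissible C Hc h -> is_expansion Y h f ->
        (sqnorm HK f)%:E = weighted_sum C Hc h /\
        (weighted_sum C Hc h < +oo)%E].
Proof.
destruct n as [|[|m]] => //.
exact: (rkhs_ball_expansion hC hKc hY hHK hHc).
Qed.
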